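(* Let $0<|q|<1$ and $u\in\mathbb{C}$. Then \begin{align*} \sum_{i,j,k\geq 0} \frac{(-1)^{k}q^{(i+j+2k)(i+j+2k-1)+j+2k^2}u^{i+2j+4k}}{(q;q)_{i}(q^2;q^2)_{j}(q^4;q^4)_{k}}&=(-u;q)_\infty, \\ \sum_{i,j,k\geq 0}\frac{(-1)^{j}q^{(i+j+2k)(i+j+2k-1)+2i+3j+2k^2+6k}}{(q;q)_{i}(q^2;q^2)_{j}(q^4;q^4)_{k}}&=\frac{(q^4,q^{12},q^{16};q^{16})_\infty}{(q^2;q^2)_\infty}, \\ \sum_{i,j,k\geq 0}\frac{(-1)^{j}q^{(i+j+2k)^2+2k^2}}{(q;q)_{i}(q^2;q^2)_{j}(q^4;q^4)_{k}}&=\frac{(q^8;q^8)_\infty^2}{(q^2;q^2)_\infty (q^{16};q^{16})_\infty}. \end{align*}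
   Context: For $a\in\mathbb{C}$ and $|p|<1$: $(a;p)_0=1$, $(a;p)_n=\prod_{k=0}^{n-1}(1-ap^k)$, $(a;p)_\infty=\prod_{k\ge0}(1-ap^k)$, and $(a_1,\dots,a_m;p)_\infty=\prod_{r=1}^m(a_r;p)_\infty$. *)

(* Defs.v *)
From HB Require Import structures.
From mathcomp Require Import all_boot all_order all_algebra finmap complex.
From mathcomp Require Import all_classical all_reals all_analysis.
From mathcomp Require summability.

Set Implicit Arguments.
Unset Strict Implicit.
Unset Printing Implicit Defensive.

Import Order.TTheory GRing.Theory Num.Theory.
Import numFieldNormedType.Exports.

Local Open Scope classical_set_scope.
Local Open Scope ring_scope.

#[export] Existing Instance summability.totally_filter.

Section QPochhammer.
Context {K : numFieldType}.
Implicit Types (a p : K).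

Definition qpoch a p (n : nat) : K := \prod_(k < n) (1 - a * p ^+ k).

(* [lim] is total; the value is only meaningful when the product converges,
   which is the case over [R[i]] as soon as [`|p| < 1]. *)
Definition qpoch_inf a p : K := lim (qpoch a p @ \oo).

Definition qpoch_inf_seq (s : seq K) p : K := \prod_(a <- s) qpoch_inf a p.

(* The value of a multiple series over i, j, k >= 0: convergence to [l] of the
   net of its finite partial sums, ordered by inclusion of the index sets.  In
   [R[i]] this is absolute convergence with sum [l]. *)
Definition has_sum3 (f : nat -> nat -> nat -> K) (l : K) : Prop :=
  summability.partial_sum (fun x : nat * nat * nat => f x.1.1 x.1.2 x.2)
    @ summability.totally --> l.

End QPochhammer.

(* Main.v *)
Require Import Defs.
From HB Require Import structures.
From mathcomp Require Import all_boot all_order all_algebra finmap complex.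
From mathcomp Require Import all_classical all_reals all_analysis.
From mathcomp Require Import zify ring.
From mathcomp Require summability.
Import Order.TTheory GRing.Theory Num.Theory.
Import numFieldNormedType.Exports.
Local Open Scope ring_scope.
Local Open Scope complex_scope.

Set Implicit Arguments.
Unset Strict Implicit.
Unset Printing Implicit Defensive.

(* Everything reduces to Euler's expansion
   [(-y;p)_oo = \sum_k p^C(k,2) y^k / (p;p)_k] and to rearranging generating
   functions in a variable [z] marking [N = i + j + 2k].

   In the first sum, [(q^2 u^4 z^2;q^4)_oo / (q u^2 z;q^2)_oo =
   (- q u^2 z;q^2)_oo] collapses [j, k] into one index [m]; the remaining double
   sum has [u^n]-coefficient [q^C(n,2) / (q;q)_n].

   In the third sum the generating function is
   [(- q^2 z^2;q^4)_oo / ((z;q)_oo (-z;q^2)_oo) =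
    (- q^2 z^2;q^4)_oo / (z^2;q^4)_oo * 1 / (q z;q^2)_oo],
   and expanding the two factors by the q-binomial theorem gives a double sum
   over [r, s] with [N = 2r + s].  Euler sums over [s] to [(- q^(4r+2);q^2)_oo],
   whose product with the [r]-th coefficient is
   [(- q^2;q^2)_oo / (q^8;q^8)_r], and Euler sums over [r].  The second sum is
   the same computation with [z] shifted in two of the three factors.

   The generating function identities are used coefficientwise, so only
   Tannery's theorem is needed to pass to the limit. *)

(** * Cauchy products of coefficient sequences *)

Section CauchyProduct.
Context {K : numFieldType}.
Implicit Types (a b c : nat -> K) (x : K) (n : nat).

Definition cprod a b n : K := \sum_(i < n.+1) a i * b (n - i)%N.

(** The substitution z -> z^2 in the generating function of [a]. *)
Definition dbl a n : K := if odd n then 0 else a n./2.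

(** Truncation to polynomials transfers the ring laws of [{poly K}] to [cprod]. *)
Lemma cprod_coef a b n N : (n < N)%N ->
  cprod a b n = (\poly_(i < N) a i * \poly_(i < N) b i)`_n.
Proof.
move=> nN; rewrite coefM; apply: eq_bigr => i _; rewrite !coef_poly.
have := ltn_ord i; rewrite ltnS => ?.
by rewrite !ifT //; apply: leq_ltn_trans nN => //; exact: leq_subr.
Qed.

Lemma cprodC a b n : cprod a b n = cprod b a n.
Proof. by rewrite !(cprod_coef _ _ (ltnSn n)) mulrC. Qed.

Lemma eq_cprod a a' b b' n : a =1 a' -> b =1 b' -> cprod a b n = cprod a' b' n.
Proof. by move=> ea eb; apply: eq_bigr => i _; rewrite ea eb. Qed.

Lemma cprodA a b c n : cprod a (cprod b c) n = cprod (cprod a b) c n.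
Proof.
have coefE f g (P : {poly K}) : (forall i, (i <= n)%N -> f i = P`_i) ->
    cprod f g n = (P * \poly_(i < n.+1) g i)`_n.
  move=> fE; rewrite coefM; apply: eq_bigr => i _.
  by rewrite fE -1?ltnS // coef_poly ltnS leq_subr.
rewrite cprodC (coefE _ _ (\poly_(i < n.+1) b i * \poly_(i < n.+1) c i)).
  rewrite (coefE _ _ (\poly_(i < n.+1) a i * \poly_(i < n.+1) b i)).
    by rewrite mulrC mulrA.
  by move=> i ?; apply: cprod_coef.
by move=> i ?; apply: cprod_coef.
Qed.

Lemma cprod0 a b : cprod a b 0 = a 0%N * b 0%N.
Proof. by rewrite /cprod big_ord1. Qed.

Lemma cprodZl x a b n : cprod (fun i => x * a i) b n = x * cprod a b n.
Proof. by rewrite /cprod mulr_sumr; apply: eq_bigr => i _; rewrite mulrA. Qed.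

Lemma cprodZr x a b n : cprod a (fun i => x * b i) n = x * cprod a b n.
Proof. by rewrite cprodC cprodZl cprodC. Qed.

Lemma cprod_geom x a b n :
  cprod (fun i => x ^+ i * a i) (fun i => x ^+ i * b i) n = x ^+ n * cprod a b n.
Proof.
rewrite /cprod mulr_sumr; apply: eq_bigr => i _.
by rewrite mulrACA -exprD subnKC // -ltnS.
Qed.

(** Division by z of a product with a factor that has no constant term. It applies after
    [cprod_qdiff] because the factors 1 - x^i vanish at i = 0. *)
Lemma cprodSl a b n : a 0%N = 0 -> cprod a b n.+1 = cprod (fun i => a i.+1) b n.
Proof. by move=> a0; rewrite /cprod big_ord_recl a0 mul0r add0r. Qed.

Lemma cprodSr a b n : b 0%N = 0 -> cprod a b n.+1 = cprod a (fun i => b i.+1) n.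
Proof. by move=> b0; rewrite cprodC cprodSl // cprodC. Qed.

(* The [q]-difference [C(z) - C(x z)] of a product [C = A B] is
   [(A(z) - A(x z)) B(z) + A(x z) (B(z) - B(x z))]. *)
Lemma cprod_qdiff x a b n :
  (1 - x ^+ n) * cprod a b n =
  cprod (fun i => (1 - x ^+ i) * a i) b n +
  cprod (fun i => x ^+ i * a i) (fun i => (1 - x ^+ i) * b i) n.
Proof.
rewrite /cprod mulr_sumr -big_split; apply: eq_bigr => i _ /=.
have -> : x ^+ n = x ^+ i * x ^+ (n - i) by rewrite -exprD subnKC // -ltnS.
by ring.
Qed.

Lemma dbl_double a n : dbl a n.*2 = a n.
Proof. by rewrite /dbl odd_double doubleK. Qed.

Lemma dbl_doubleS a n : dbl a n.*2.+1 = 0.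
Proof. by rewrite /dbl /= odd_double. Qed.

(** Since [F] vanishes from [n] on, the left sum may run up to 2n; its odd terms are zero and its
    even terms form the right sum. *)
Lemma sum_dbl (F : nat -> K) a n : (forall m, (n <= m)%N -> F m = 0) ->
  \sum_(m < n) F m * dbl a m = \sum_(k < n) F k.*2 * a k.
Proof.
move=> F0.
have widen (G : nat -> K) : (forall m, (n <= m)%N -> G m = 0) ->
    \sum_(m < n) G m = \sum_(m < n.*2) G m.
  move=> G0; rewrite -addnn big_split_ord /= [X in _ + X]big1 ?addr0 // => i _.
  by rewrite G0 // leq_addr.
rewrite (widen (fun m => F m * dbl a m)); last by move=> m /F0 ->; rewrite mul0r.
elim: {widen F0} n => [|n IHn]; first by rewrite !big_ord0.
by rewrite doubleS !big_ord_recr /= IHn dbl_double dbl_doubleS mulr0 addr0.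
Qed.

(** For odd n the indices i and n - i have opposite parities, so each term vanishes; for even n only
    even i survive. *)
Lemma cprod_dbl a b n : cprod (dbl a) (dbl b) n = dbl (cprod a b) n.
Proof.
rewrite /cprod -[n]odd_double_half; case: (odd n) => /=.
  rewrite add1n dbl_doubleS big1 // => i _.
  rewrite /dbl; case: ifP => io; first by rewrite mul0r.
  by rewrite oddB ?io /= ?odd_double ?mulr0 // -ltnS.
rewrite add0n dbl_double; set m := n./2.
(* Extension by 0 beyond 2m, where truncated subtraction would give [dbl b 0] instead. *)
pose F i := if (i < m.*2.+1)%N then dbl b (m.*2 - i) else 0.
transitivity (\sum_(i < m.*2.+1) F i * dbl a i).
  by apply: eq_bigr => i _; rewrite /F ltn_ord mulrC.
rewrite sum_dbl => [|i]; last by rewrite /F leqNgt => /negPf ->.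
have mm : (m.+1 <= m.*2.+1)%N by rewrite ltnS -addnn leq_addr.
rewrite (bigID (fun i : 'I__ => (i < m.+1)%N)) /= [X in _ + X]big1 ?addr0; last first.
  by move=> i im; rewrite /F ltnS leq_double -ltnS (negPf im) mul0r.
rewrite -(big_ord_widen _ (fun i => F i.*2 * a i) mm).
apply: eq_bigr => i _.
by rewrite /F ltnS leq_double -ltnS ltn_ord -doubleB dbl_double mulrC.
Qed.

(** Induction on [n]: each step adds the diagonal i + j = n on both sides. *)
Lemma sum_triangle (G : nat -> nat -> K) n :
  \sum_(s < n) \sum_(i < s.+1) G i (s - i)%N =
  \sum_(i < n) \sum_(j < n) (if (i + j < n)%N then G i j else 0).
Proof.
elim: n => [|n IHn]; first by rewrite !big_ord0.
rewrite big_ord_recr IHn /=.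
transitivity (\sum_(i < n) \sum_(j < n.+1) (if (i + j < n)%N then G i j else 0)
   + \sum_(i < n.+1) \sum_(j < n.+1) (if (i + j == n)%N then G i j else 0)).
  congr (_ + _); apply: eq_bigr => i _.
    by rewrite big_ord_recr /= ifF ?addr0 // ltnNge leq_addl.
  have le_in : (i <= n)%N by rewrite -ltnS.
  rewrite -big_mkcond (big_pred1 (Ordinal (leq_ltn_trans (leq_subr i n) (ltnSn n)))) //.
  by move=> j /=; rewrite -[RHS]val_eqE /=; apply/eqP/eqP; lia.
rewrite [X in _ = X]big_ord_recr [X in _ + X = _]big_ord_recr /= addrA -big_split /=.
congr (_ + _); apply: eq_bigr => i _.
  rewrite -big_split; apply: eq_bigr => j _ /=.
  rewrite [X in _ = (if X then _ else _)]ltnS [X in _ = (if X then _ else _)]leq_eqVlt.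
  by case: eqP => [->|_] /=; rewrite ?ltnn ?add0r ?addr0.
by rewrite ltnS leq_eqVlt [(n + i < n)%N]ltnNge leq_addr orbF.
Qed.

(** This evaluates the linear functional z^m -> F m on a product of generating functions; the
    vanishing of [F] from [n] on lets i and j range over a square. *)
Lemma sum_cprod (F : nat -> K) a b n : (forall m, (n <= m)%N -> F m = 0) ->
  \sum_(m < n) F m * cprod a b m =
  \sum_(i < n) \sum_(j < n) F (i + j)%N * (a i * b j).
Proof.
move=> F0.
transitivity (\sum_(s < n) \sum_(i < s.+1) F (i + (s - i))%N * (a i * b (s - i)%N)).
  apply: eq_bigr => s _; rewrite mulr_sumr; apply: eq_bigr => i _.
  by rewrite subnKC // -ltnS.
rewrite (sum_triangle (fun i j => F (i + j)%N * (a i * b j))).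
apply: eq_bigr => i _; apply: eq_bigr => j _.
by case: ltnP => // /F0 ->; rewrite mul0r.
Qed.

End CauchyProduct.

(** * Coefficient identities proved by q-difference recurrences *)

Section QIdentities.
Context {K : numFieldType}.
Implicit Types (p q x y : K) (n : nat).

Lemma qpochS x p n : qpoch x p n.+1 = qpoch x p n * (1 - x * p ^+ n).
Proof. by rewrite /qpoch big_ord_recr. Qed.

Lemma qpoch0 x p : qpoch x p 0 = 1.
Proof. by rewrite /qpoch big_ord0. Qed.

Lemma norm_expr_lt1 p n : `|p| < 1 -> `|p ^+ n.+1| < 1.
Proof. by move=> p1; rewrite normrX exprn_ilt1. Qed.

Lemma onem_exprS_neq0 p n : `|p| < 1 -> 1 - p ^+ n.+1 != 0.
Proof.
move=> /(norm_expr_lt1 n) p1; rewrite subr_eq0; apply: contraTneq p1 => <-.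
by rewrite normr1 ltxx.
Qed.

Lemma qpoch_neq0 p n : `|p| < 1 -> qpoch p p n != 0.
Proof.
move=> p1; elim: n => [|n IHn]; first by rewrite qpoch0 oner_neq0.
by rewrite qpochS mulf_neq0 // -exprS onem_exprS_neq0.
Qed.

(** By Euler, these are the coefficients of 1/(z;p)_oo, and inserting y^n replaces z by y z. Cauchy
    products of such sequences thus stand for products of infinite products. *)
Definition invqf p n : K := (qpoch p p n)^-1.

Lemma invqf0 p : invqf p 0 = 1.
Proof. by rewrite /invqf qpoch0 invr1. Qed.

Lemma invqfS p n : `|p| < 1 -> (1 - p ^+ n.+1) * invqf p n.+1 = invqf p n.
Proof.
move=> p1; rewrite /invqf qpochS -exprS invfM mulrCA mulfV ?mulr1 //.
exact: onem_exprS_neq0.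
Qed.

Lemma exprS_binS p n : p ^+ 'C(n.+1, 2) = p ^+ 'C(n, 2) * p ^+ n.
Proof. by rewrite binS bin1 exprD. Qed.

(** The q-binomial theorem for (-y z;p)_oo / (z;p)_oo. Both sides satisfy (1 - p^(n+1)) c_(n+1) = (1
    + y p^n) c_n with c_0 = 1. *)
Lemma cauchy_binomial p y n : `|p| < 1 ->
  cprod (invqf p) (fun k => p ^+ 'C(k, 2) * y ^+ k * invqf p k) n =
  qpoch (- y) p n * invqf p n.
Proof.
move=> p1; elim: n => [|n IHn].
  by rewrite cprod0 qpoch0 !invqf0 !expr0 !mulr1.
apply: (mulfI (onem_exprS_neq0 n p1)).
rewrite cprod_qdiff cprodSl ?subrr ?mul0r // cprodSr ?subrr ?mul0r //=.
rewrite [RHS]mulrCA (invqfS _ p1) qpochS mulNr opprK mulrAC -IHn.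
rewrite (eq_cprod (a' := invqf p)
  (b' := (fun k => p ^+ 'C(k, 2) * y ^+ k * invqf p k))) //; last first.
  by move=> i; rewrite invqfS.
rewrite mulrDr mulr1; congr (_ + _).
rewrite (eq_cprod (a' := fun i => p ^+ i * invqf p i)
  (b' := (fun k => p ^+ k * (y * (p ^+ 'C(k, 2) * y ^+ k * invqf p k))))) //.
  by rewrite cprod_geom cprodZr mulrA mulrC [y * _]mulrC.
move=> i; rewrite mulrCA (invqfS _ p1) exprS_binS exprS; ring.
Qed.

(** Coefficient form of (z;q)_oo = (z;q^2)_oo (q z;q^2)_oo. Both sides satisfy (1 - q^(2(n+1)))
    c_(n+1) = (1 + q^(n+1)) c_n. *)
Lemma cprod_invqf_sqr q n : `|q| < 1 ->
  cprod (invqf (q ^+ 2)) (fun i => q ^+ i * invqf (q ^+ 2) i) n = invqf q n.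
Proof.
move=> q1; have q21 : `|q ^+ 2| < 1 by exact: norm_expr_lt1.
elim: n => [|n IHn]; first by rewrite cprod0 !invqf0 expr0 !mulr1.
apply: (mulfI (onem_exprS_neq0 n q21)).
rewrite cprod_qdiff cprodSl ?subrr ?mul0r // cprodSr ?subrr ?mul0r //=.
rewrite (eq_cprod (a' := invqf (q ^+ 2))
  (b' := fun i => q ^+ i * invqf (q ^+ 2) i)) //; last first.
  by move=> i; rewrite invqfS.
rewrite IHn [cprod _ _ _ in X in _ + X](eq_cprod
  (a' := fun i => q ^+ i * (q ^+ i * invqf (q ^+ 2) i))
  (b' := fun i => q ^+ i * (q * invqf (q ^+ 2) i))); last 2 first.
- by move=> i; rewrite mulrA -expr2 exprAC.
- by move=> i; rewrite mulrCA (invqfS _ q21) exprS; ring.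
rewrite cprod_geom cprodZr cprodC IHn -(invqfS n q1) exprAC exprS; ring.
Qed.

(** Coefficient form of (z;p)_oo (-z;p)_oo = (z^2;p^2)_oo. *)
Lemma cprod_invqf_alt p n : `|p| < 1 ->
  cprod (invqf p) (fun i => (-1) ^+ i * invqf p i) n = dbl (invqf (p ^+ 2)) n.
Proof.
move=> p1; set b := fun i => _; set c := cprod _ b.
have p21 : `|p ^+ 2| < 1 by exact: norm_expr_lt1.
(* With C = A B, this is D(z) = A(p z) B(z) = (1 - z) C(z). Eliminating D from [cS] by [dE] gives
   the step-two recurrence (1 - p^(m+2)) c_(m+2) = c_m. *)
pose d := cprod (fun i => p ^+ i * invqf p i) b.
have cS m : (1 - p ^+ m.+1) * c m.+1 = c m - d m.
  rewrite /c cprod_qdiff cprodSl ?subrr ?mul0r // cprodSr ?subrr ?mul0r //=.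
  rewrite (eq_cprod (a' := invqf p) (b' := b)) // => [|i]; last by rewrite invqfS.
  congr (_ + _); rewrite -mulN1r -cprodZr; apply: eq_cprod => // i.
  by rewrite /b mulrCA (invqfS _ p1) exprS mulrA.
have dE m : c m.+1 - d m.+1 = c m.
  rewrite /c /d.
  have -> : cprod (invqf p) b m = cprod (fun i => (1 - p ^+ i.+1) * invqf p i.+1) b m.
    by apply: eq_cprod => // i; rewrite invqfS.
  rewrite -(cprodSl (a := fun i => (1 - p ^+ i) * invqf p i)) ?subrr ?mul0r //.
  by rewrite /cprod -sumrB; apply: eq_bigr => i _ /=; ring.
have c0 : c 0%N = 1 by rewrite /c cprod0 /b !invqf0 expr0 !mulr1.
have c1 : c 1%N = 0.
  apply: (mulfI (onem_exprS_neq0 0 p1)); rewrite cS mulr0 c0.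
  by rewrite /d cprod0 /b !invqf0 expr0 !mulr1 subrr.
have cdbl m : c m.*2 = invqf (p ^+ 2) m /\ c m.*2.+1 = 0.
  elim: m => [|m [IH1 IH2]]; first by rewrite c0 c1 invqf0.
  split.
    apply: (mulfI (onem_exprS_neq0 m p21)); rewrite (invqfS _ p21) -exprM mul2n.
    by rewrite doubleS cS dE IH1.
  apply: (mulfI (onem_exprS_neq0 m.*2.+2 p1)); rewrite doubleS mulr0.
  by rewrite cS dE IH2.
rewrite -[n]odd_double_half /dbl; case: (odd n) => /=.
  by rewrite add1n odd_double /=; case: (cdbl n./2).
by rewrite add0n odd_double doubleK; case: (cdbl n./2).
Qed.

(** Coefficient form of (q^2 z^2;q^4)_oo / (q z;q^2)_oo = (-q z;q^2)_oo. The even factor has a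
    recurrence of step two, so the product has a three-term recurrence, which the right side also
    satisfies. *)
Lemma cprod_invqf_dbl_alt q n : `|q| < 1 ->
  cprod (fun j => q ^+ j * invqf (q ^+ 2) j)
    (dbl (fun k => (-1) ^+ k * q ^+ (2 * k ^ 2) * invqf (q ^+ 4) k)) n =
  q ^+ (n ^ 2) * invqf (q ^+ 2) n.
Proof.
move=> q1; set A := fun j => _; set D := dbl _; set c := cprod A D.
have q21 : `|q ^+ 2| < 1 by exact: norm_expr_lt1.
have q41 : `|q ^+ 4| < 1 by exact: norm_expr_lt1.
have AS i : (1 - q ^+ 2 ^+ i.+1) * A i.+1 = q * A i.
  by rewrite /A mulrCA (invqfS _ q21) exprS mulrA.
have DS i : (1 - q ^+ 2 ^+ i.+2) * D i.+2 = - q ^+ 2 * (q ^+ 2 ^+ i * D i).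
  rewrite /D /dbl /= negbK; case: ifP => io; first by rewrite !mulr0.
  have -> : q ^+ 2 ^+ i.+2 = q ^+ 4 ^+ i./2.+1.
    by rewrite -!exprM; congr (_ ^+ _); lia.
  rewrite mulrCA (invqfS _ q41) exprS -exprM.
  have -> : (2 * i./2.+1 ^ 2 = 2 * i./2 ^ 2 + 2 * i + 2)%N.
    by lia.
  rewrite !exprD; ring.
have D1 : D 1%N = 0 by [].
have D0 : D 0%N = 1 by rewrite /D /dbl /= invqf0 expr0 !mulr1.
have c0 : c 0%N = 1 by rewrite /c cprod0 D0 /A invqf0 expr0 !mulr1.
have cS m : (1 - q ^+ 2 ^+ m.+2) * c m.+2 = q * c m.+1 - q ^+ 2 * q ^+ 2 ^+ m * c m.
  rewrite /c cprod_qdiff cprodSl ?subrr ?mul0r //.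
  rewrite [X in _ + X]cprodSr ?subrr ?mul0r // [X in _ + X]cprodSr ?D1 ?mulr0 //=.
  rewrite (eq_cprod (a' := fun i => q * A i) (b' := D)) // cprodZl; congr (_ + _).
  rewrite (eq_cprod (a' := fun i => (q ^+ 2) ^+ i * A i)
    (b' := fun i => - q ^+ 2 * (q ^+ 2 ^+ i * D i))) //.
  by rewrite cprodZr cprod_geom mulNr mulrA.
have c1 : (1 - q ^+ 2) * c 1%N = q.
  rewrite -[q ^+ 2]expr1 /c cprod_qdiff cprodSl ?subrr ?mul0r //.
  rewrite [X in _ + X]cprodSr ?subrr ?mul0r // !cprod0 AS D0 D1 mulr0 mulr0 addr0 mulr1.
  by rewrite /A invqf0 expr0 !mulr1.
have E0 := invqfS _ q21.
suff [] : c n = q ^+ (n ^ 2) * invqf (q ^+ 2) n /\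
   c n.+1 = q ^+ (n.+1 ^ 2) * invqf (q ^+ 2) n.+1 by [].
elim: n => [|n [IH1 IH2]].
  split; first by rewrite c0 invqf0 mulr1.
  apply: (mulfI (onem_exprS_neq0 0 q21)); rewrite [RHS]mulrCA E0 invqf0.
  by rewrite c1 mulr1.
split => //; apply: (mulfI (onem_exprS_neq0 n.+1 q21)).
rewrite cS IH1 IH2 [RHS]mulrCA E0 -(E0 n).
have -> : (n.+2 ^ 2 = n ^ 2 + n + n + n + n + 4)%N by lia.
have -> : (n.+1 ^ 2 = n ^ 2 + n + n + 1)%N by lia.
have Q2 k : (q ^+ 2) ^+ k = q ^+ k * q ^+ k by rewrite exprAC expr2.
by rewrite !Q2 -![n.+1]addn1 !exprD; ring.
Qed.

End QIdentities.

(** * The finite sum giving the u^n-coefficient of the first series *)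

Section DoubleSum.
Context {K : numFieldType}.
Implicit Types (p q x y : K) (n : nat).

(** The contribution of i = n - 2m, with i + m written n - m; the extension by 0 covers 2m > n. *)
Let term q n m : K :=
  if (m.*2 <= n)%N then
    q ^+ ((n - m) * (n - m - 1) + m ^ 2) * invqf q (n - m.*2) * invqf (q ^+ 2) m
  else 0.

Let termS0 q n : `|q| < 1 ->
  (1 - q ^+ n.+1) * term q n.+1 0 = q ^+ (2 * n) * term q n 0.
Proof.
move=> q1; rewrite /term double0 !leq0n !subn0 -(invqfS n q1).
have -> : (n.+1 * (n.+1 - 1) + 0 ^ 2 = 2 * n + (n * (n - 1) + 0 ^ 2))%N by nia.
by rewrite exprD; ring.
Qed.

(** The split is chosen for summation over m: the two coefficients that [term q n m] then receives,
    q^(2(n-m)) and q^n - q^(2(n-m)), add up to q^n. This yields the recurrence of q^C(n,2) /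
    (q;q)_n. *)
Let termSS q n m : `|q| < 1 ->
  (1 - q ^+ n.+1) * term q n.+1 m.+1 =
  q ^+ (2 * (n - m.+1)) * term q n m.+1 +
  (q ^+ n - q ^+ (2 * (n - m))) * term q n m.
Proof.
move=> q1; have q21 : `|q ^+ 2| < 1 by exact: norm_expr_lt1.
(* At the boundary n <= 2m the terms with [m.+1] vanish; so does [term q n m] if n < 2m, and its
   coefficient if n = 2m. *)
case: (leqP m.*2.+1 n) => [mn|nm]; last first.
  have -> : term q n.+1 m.+1 = 0 by rewrite /term ifF //; lia.
  have -> : term q n m.+1 = 0 by rewrite /term ifF //; lia.
  rewrite !mulr0 add0r; case: (ltngtP m.*2 n) => [|n2|n2]; first by lia.
    by rewrite /term ifF ?mulr0 //; lia.
  by rewrite (_ : 2 * (n - m) = n)%N ?subrr ?mul0r //; lia.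
have [r ->] : exists r, n = (m.*2.+1 + r)%N by exists (n - m.*2.+1)%N; lia.
have -> : term q (m.*2.+1 + r).+1 m.+1 = q ^+ ((m + r) * (m + r + 1) + (m + 1) ^ 2)
    * invqf q r * invqf (q ^+ 2) m.+1.
  rewrite /term ifT; last by lia.
  by congr (_ ^+ _ * invqf _ _ * _); nia.
have -> : term q (m.*2.+1 + r) m = q ^+ ((m + r) * (m + r + 1) + m ^ 2)
    * invqf q r.+1 * invqf (q ^+ 2) m.
  rewrite /term ifT; last by lia.
  by congr (_ ^+ _ * invqf _ _ * _); nia.
(* The product (1 - q^r) / (q;q)_r stands for 1/(q;q)_(r-1) and is correctly 0 at r = 0. *)
have -> : q ^+ (2 * (m.*2.+1 + r - m.+1)) * term q (m.*2.+1 + r) m.+1 =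
   q ^+ ((m + r) * (m + r + 1) + (m + 1) ^ 2) * ((1 - q ^+ r) * invqf q r)
     * invqf (q ^+ 2) m.+1.
  case: r => [|r]; first by rewrite subrr mul0r !mulr0 mul0r /term ifF ?mulr0 //; lia.
  rewrite (invqfS r q1) /term ifT; last by lia.
  rewrite !mulrA -exprD; congr (_ ^+ _ * invqf _ _ * _); nia.
rewrite -(invqfS m q21) -(invqfS r q1) -!exprM.
have -> : ((m.*2.+1 + r).+1 = 2 * m + 2 + r)%N by lia.
have -> : (2 * (m.*2.+1 + r - m) = 2 * m + 2 * r + 2)%N by lia.
have -> : ((m + 1) ^ 2 = m ^ 2 + 2 * m + 1)%N by nia.
have -> : (m.*2.+1 + r = 2 * m + 1 + r)%N by lia.
have -> : (2 * m.+1 = 2 * m + 2)%N by lia.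
have -> : (2 * r = r + r)%N by lia.
rewrite -[r.+1]addn1 !exprD.  ring.
Qed.

Let sum_term q n : `|q| < 1 ->
  \sum_(m < n.+1) term q n m = q ^+ 'C(n, 2) * invqf q n.
Proof.
move=> q1; elim: n => [|n IHn].
  by rewrite big_ord1 /term /= !invqf0 !mulr1.
apply: (mulfI (onem_exprS_neq0 n q1)).
rewrite mulr_sumr big_ord_recl termS0 //.
under eq_bigr do rewrite termSS //.
rewrite big_split addrA /= [RHS]mulrCA (invqfS _ q1) exprS_binS mulrAC -IHn.
have -> : q ^+ (2 * n) * term q n 0 + \sum_(i < n.+1) q ^+ (2 * (n - i.+1)) * term q n i.+1 =
   \sum_(i < n.+1) q ^+ (2 * (n - i)) * term q n i.
  transitivity (\sum_(i < n.+2) q ^+ (2 * (n - i)) * term q n i).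
    by rewrite [RHS]big_ord_recl /= subn0.
  by rewrite big_ord_recr /= {2}/term ifF ?mulr0 ?addr0 //; lia.
rewrite -big_split mulr_suml; apply: eq_bigr => i _ /=; ring.
Qed.

Lemma sum_invqf_triangle q n : `|q| < 1 ->
  \sum_(i < n.+1) q ^+ ((i + (n - i)./2) * (i + (n - i)./2 - 1)) *
     (invqf q i * dbl (fun m => q ^+ (m ^ 2) * invqf (q ^+ 2) m) (n - i)) =
  q ^+ 'C(n, 2) * invqf q n.
Proof.
move=> q1; rewrite -sum_term //.
pose F l := if (l < n.+1)%N then
   q ^+ ((n - l + l./2) * (n - l + l./2 - 1)) * invqf q (n - l) else 0.
transitivity (\sum_(l < n.+1) F l * dbl (fun m => q ^+ (m ^ 2) * invqf (q ^+ 2) m) l).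
  rewrite (reindex_inj rev_ord_inj) /=; apply: eq_bigr => l _.
  have ln := ltn_ord l; rewrite /F ln subSS subKn //.
  by rewrite mulrA.
rewrite sum_dbl => [|m]; last by rewrite /F leqNgt => /negPf ->.
apply: eq_bigr => m _; rewrite /F /term ltnS doubleK; case: ifP => mn.
  rewrite (_ : n - m.*2 + m = n - m)%N; last by lia.
  by rewrite exprD; ring.
by rewrite mul0r.
Qed.

End DoubleSum.

Lemma bin2_sqr k : (k ^ 2 = 2 * 'C(k, 2) + k)%N.
Proof. by elim: k => // k IHk; rewrite binS bin1; lia. Qed.

(** * From triple to double Cauchy products *)

Section TripleSums.
Context {K : numFieldType}.
Implicit Types (p q x y : K) (n : nat).

Lemma sum_cprod_dbl (F : nat -> K) (a b : nat -> K) n :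
  (forall m, (n <= m)%N -> F m = 0) ->
  \sum_(m < n) F m * cprod a (dbl b) m =
  \sum_(i < n) \sum_(k < n) F (i + 2 * k)%N * (a i * b k).
Proof.
move=> F0; rewrite sum_cprod //; apply: eq_bigr => i _.
under eq_bigr do rewrite mulrA.
rewrite (sum_dbl b (F := fun m => F (i + m)%N * a i)) => [|m nm].
  by apply: eq_bigr => k _; rewrite mul2n mulrA.
by rewrite F0 ?mul0r //; lia.
Qed.

Lemma sum_cprod3_dbl (F : nat -> K) (a b c : nat -> K) n :
  (forall m, (n <= m)%N -> F m = 0) ->
  \sum_(m < n) F m * cprod a (cprod b (dbl c)) m =
  \sum_(i < n) \sum_(j < n) \sum_(k < n)
     F (i + j + 2 * k)%N * (a i * b j * c k).
Proof.
move=> F0; rewrite sum_cprod //; apply: eq_bigr => i _.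
under eq_bigr do rewrite mulrA.
rewrite (sum_cprod_dbl b c (F := fun m => F (i + m)%N * a i)) => [|m nm].
  apply: eq_bigr => j _; apply: eq_bigr => k _.
  by rewrite addnA; ring.
by rewrite F0 ?mul0r //; lia.
Qed.

(** Splitting 1/(z;q)_oo into 1/(q z;q^2)_oo and 1/(z;q^2)_oo, the latter merges with 1/(-z;q^2)_oo
    into 1/(z^2;q^4)_oo; [cauchy_binomial] in z^2 with y = q^2 then absorbs the last factor. *)
Lemma cprod_invqf3 q n : `|q| < 1 ->
  cprod (invqf q) (cprod (fun j => (-1) ^+ j * invqf (q ^+ 2) j)
    (dbl (fun k => q ^+ (2 * k ^ 2) * invqf (q ^+ 4) k))) n =
  cprod (fun s => q ^+ s * invqf (q ^+ 2) s)
    (dbl (fun r => qpoch (- q ^+ 2) (q ^+ 4) r * invqf (q ^+ 4) r)) n.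
Proof.
move=> q1; have q21 : `|q ^+ 2| < 1 by exact: norm_expr_lt1.
have q41 : `|q ^+ 4| < 1 by exact: norm_expr_lt1.
set b := fun j => (-1) ^+ j * _; set g := fun s => q ^+ s * _; set c := dbl _.
rewrite (eq_cprod (a' := cprod g (invqf (q ^+ 2))) (b' := cprod b c)) //; last first.
  by move=> i; rewrite cprodC cprod_invqf_sqr.
rewrite -cprodA; apply: eq_cprod => // m; rewrite cprodA.
rewrite (eq_cprod (a' := dbl (invqf (q ^+ 4))) (b' := c)) // => [|i]; last first.
  by rewrite cprod_invqf_alt // -exprM.
rewrite cprod_dbl /dbl; case: ifP => // _; rewrite -cauchy_binomial //.
apply: eq_cprod => // k; rewrite -!exprM -exprD; congr (_ ^+ _ * _).
by rewrite bin2_sqr; lia.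
Qed.

(** Here 1/(q z;q^2)_oo is the half that merges, with 1/(-q z;q^2)_oo, and 1/(z;q^2)_oo remains. The
    q-binomial theorem is applied in q^2 z^2, whence q^(2r). *)
Lemma cprod_invqf3_shift q n : `|q| < 1 ->
  cprod (invqf q) (cprod (fun j => (-1) ^+ j * q ^+ j * invqf (q ^+ 2) j)
    (dbl (fun k => q ^+ (2 * k ^ 2 + 2 * k) * invqf (q ^+ 4) k))) n =
  cprod (invqf (q ^+ 2))
    (dbl (fun r => q ^+ (2 * r) * (qpoch (- q ^+ 2) (q ^+ 4) r * invqf (q ^+ 4) r))) n.
Proof.
move=> q1; have q21 : `|q ^+ 2| < 1 by exact: norm_expr_lt1.
have q41 : `|q ^+ 4| < 1 by exact: norm_expr_lt1.
set b := fun j => (-1) ^+ j * _ * _; set c := dbl _.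
rewrite (eq_cprod (b' := cprod b c) _ (fun i => esym (cprod_invqf_sqr i q1))) //.
rewrite -cprodA; apply: eq_cprod => // m; rewrite cprodA.
rewrite (eq_cprod (a' := dbl (fun r => q ^+ (2 * r) * invqf (q ^+ 4) r))
  (b' := c)) // => [|i]; last first.
  rewrite (eq_cprod (a' := fun i => q ^+ i * invqf (q ^+ 2) i)
     (b' := fun i => q ^+ i * ((-1) ^+ i * invqf (q ^+ 2) i))) // => [|k]; last first.
    by rewrite /b; ring.
  rewrite cprod_geom cprod_invqf_alt // -exprM /dbl; case: ifP => io.
    by rewrite mulr0.
  by congr (_ ^+ _ * _); lia.
rewrite cprod_dbl /dbl; case: ifP => // _; rewrite exprM -cauchy_binomial //.
rewrite -cprod_geom; apply: eq_cprod => k; rewrite -?exprM // mulrA.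
congr (_ * _); rewrite -!exprD; congr (_ ^+ _).
by rewrite bin2_sqr; lia.
Qed.

End TripleSums.

(** * Tannery's theorem and growth bounds *)

Section Convergence.
Local Open Scope classical_set_scope.
Context {K : numFieldType}.
Implicit Types (y M eps : K) (g : nat -> nat -> nat -> K).

Lemma cvg_sum_ord (a : nat -> nat -> K) (b : nat -> K) N :
  (forall k, a n k @[n --> \oo] --> b k) ->
  \sum_(k < N) a n k @[n --> \oo] --> \sum_(k < N) b k.
Proof.
move=> ab; elim: N => [|N IHN].
  by rewrite big_ord0; under eq_fun do rewrite big_ord0; exact: cvg_cst.
by rewrite big_ord_recr; under eq_fun do rewrite big_ord_recr; exact: cvgD.
Qed.

Lemma half_exp_ge0 n : 0 <= 2^-1 ^+ n :> K.
Proof. by rewrite exprn_ge0 // invr_ge0 ler0n. Qed.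

Lemma sum_half_exp_le2 n : \sum_(k < n) 2^-1 ^+ k <= 2 :> K.
Proof.
have -> : \sum_(k < n) 2^-1 ^+ k = 2 - 2 * 2^-1 ^+ n :> K.
  elim: n => [|n IHn]; first by rewrite big_ord0 expr0 mulr1 subrr.
  rewrite big_ord_recr /= IHn exprS mulrA mulfV ?pnatr_eq0 //; ring.
by rewrite gerBl mulr_ge0 ?half_exp_ge0 // ler0n.
Qed.

Lemma sum_half_exp_tail N n : \sum_(k < n) 2^-1 ^+ (N + k) <= 2 * 2^-1 ^+ N :> K.
Proof.
under eq_bigr do rewrite exprD.
by rewrite -mulr_sumr mulrC ler_wpM2r ?half_exp_ge0 // sum_half_exp_le2.
Qed.

(* [R[i]] carries no complete normed structure in the library, so the two facts
   on convergence needed below are assumptions on [K], proved for [R[i]] at the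
   end. *)
Context (geomK : forall x : K, `|x| < 1 -> x ^+ n @[n --> \oo] --> 0).

Lemma cvg_half_exp : 2^-1 ^+ n @[n --> \oo] --> (0 : K).
Proof.
apply: geomK; rewrite ger0_norm ?invr_ge0 ?ler0n //.
by rewrite invf_lt1 ?ltr0n // ltr1n.
Qed.

Lemma half_exp_lt eps M : 0 < eps -> 0 <= M ->
  \forall n \near \oo, M * 2^-1 ^+ n < eps.
Proof.
move=> e0 M0; have : M * 2^-1 ^+ n @[n --> \oo] --> M * 0.
  by apply: cvgM; [exact: cvg_cst|exact: cvg_half_exp].
rewrite mulr0 => /cvgrPdist_lt/(_ _ e0); apply: filterS => n.
by rewrite sub0r normrN ger0_norm // mulr_ge0 ?half_exp_ge0.
Qed.

(** The geometric majorant makes the tail beyond a fixed N small uniformly in n; the first N terms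
    converge one by one. The upper limit [n.+1] is the length of a [cprod]. *)
Lemma tannery (a : nat -> nat -> K) (b : nat -> K) M (l : K) :
  (forall n k, `|a n k| <= M * 2^-1 ^+ k) ->
  (forall k, a n k @[n --> \oo] --> b k) ->
  \sum_(k < n) b k @[n --> \oo] --> l ->
  \sum_(k < n.+1) a n k @[n --> \oo] --> l.
Proof.
move=> aM ab bl; apply/cvgrPdist_lt => e e0.
have M0 : 0 <= M by have /(le_trans (normr_ge0 _)) := aM 0%N 0%N; rewrite expr0 mulr1.
have e3 : 0 < e / 3 by rewrite divr_gt0 // ltr0n.
have [N _ /(_ N (leqnn N)) /= []] : \forall n \near \oo,
    `|l - \sum_(k < n) b k| < e / 3 /\ M * 2 * 2^-1 ^+ n < e / 3.
  apply: filterI; first by move/cvgrPdist_lt : bl; exact.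
  by apply: half_exp_lt; rewrite // mulr_ge0 ?ler0n.
move=> blN MN.
have /cvgrPdist_lt/(_ _ e3) aN := @cvg_sum_ord a b N ab.
near=> n.
have [d nd] : exists d, n.+1 = (N + d)%N.
  exists (n.+1 - N)%N; rewrite subnKC // leqW //.
  by near: n; exact: nbhs_infty_ge.
have -> : l - \sum_(k < n.+1) a n k =
    (l - \sum_(k < N) b k) + (\sum_(k < N) b k - \sum_(k < N) a n k)
    - \sum_(k < d) a n (N + k)%N.
  by rewrite nd big_split_ord /=; ring.
have -> : e = e / 3 + e / 3 + e / 3 by field.
apply: le_lt_trans (ler_normB _ _) _; apply: ltr_leD.
  apply: le_lt_trans (ler_normD _ _) _; apply: ltrD => //.
  by near: n.
apply: le_trans (ltW MN); apply: le_trans (ler_norm_sum _ _ _) _.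
apply: (@le_trans _ _ (\sum_(k < d) M * 2^-1 ^+ (N + k))).
  by apply: ler_sum => k _; exact: aM.
by rewrite -mulr_sumr -mulrA ler_wpM2l // sum_half_exp_tail.
Unshelve. all: by end_near. Qed.

(** The ratio x^n c of consecutive terms tends to 0, so the sequence eventually decreases; the sum
    of the initial nonnegative terms serves as their maximum. *)
Lemma super_geometric_bound (x c : K) : 0 <= x < 1 -> 0 <= c ->
  exists C, 0 <= C /\ forall n, x ^+ 'C(n, 2) * c ^+ n <= C.
Proof.
move=> /andP[x0 x1] c0; pose v n := x ^+ 'C(n, 2) * c ^+ n.
have v0 n : 0 <= v n by rewrite mulr_ge0 ?exprn_ge0.
have vS n : v n.+1 = v n * (x ^+ n * c) by rewrite /v exprS_binS exprS; ring.
have /cvgrPdist_lt/(_ 1 ltr01)[N _ xN] : x ^+ n * c @[n --> \oo] --> 0 * c.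
  by apply: cvgM; [apply: geomK; rewrite ger0_norm|exact: cvg_cst].
have vN n : v (N + n)%N <= v N.
  elim: n => [|n IHn]; first by rewrite addn0.
  rewrite addnS vS; apply: le_trans IHn; rewrite ler_piMr //.
  have := xN (N + n)%N (leq_addr _ _); rewrite /= mul0r sub0r normrN ger0_norm.
    exact: ltW.
  by rewrite mulr_ge0 ?exprn_ge0.
exists (\sum_(k < N.+1) v k); split; first by apply: sumr_ge0.
have le_sum k : (k <= N)%N -> v k <= \sum_(k < N.+1) v k.
  rewrite -ltnS => kN; rewrite (bigD1 (Ordinal kN)) //= lerDl.
  by apply: sumr_ge0.
move=> n; case: (leqP n N) => [/le_sum //|/ltnW/subnKC <-].
exact: le_trans (vN _) (le_sum _ (leqnn N)).
Qed.

Lemma super_geometric_bound_geom (x c : K) y : 0 <= x < 1 -> 0 <= c -> 0 < y ->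
  exists C, 0 <= C /\ forall n, x ^+ 'C(n, 2) * c ^+ n <= C * y ^+ n.
Proof.
move=> x01 c0 y0; have [|C [C0 HC]] := @super_geometric_bound x (c / y) x01.
  by rewrite divr_ge0 // ltW.
exists C; split=> // n; rewrite -ler_pdivrMr ?exprn_gt0 //.
by rewrite -mulrA -expr_div_n.
Qed.

(** * Unordered triple sums as limits of weighted box sums *)

Section BoxSums.

(** The cut by the weight [w] makes partial sums agree with truncation of a generating function in
    which [w] is the exponent of the variable. *)
Definition box_sum (w : nat -> nat -> nat -> nat) g n : K :=
  \sum_(i < n) \sum_(j < n) \sum_(k < n)
    (if (w i j k < n)%N then g i j k else 0).

Lemma sum_ord_widen (a : nat -> K) n m : (n <= m)%N ->
  (forall i, (n <= i)%N -> a i = 0) -> \sum_(i < n) a i = \sum_(i < m) a i.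
Proof.
move=> nm a0; rewrite (big_ord_widen _ a nm) big_mkcond; apply: eq_bigr => i _.
by case: ltnP => // /a0.
Qed.

Let trip m (p : 'I_m * 'I_m * 'I_m) : nat * nat * nat :=
  (p.1.1 : nat, p.1.2 : nat, p.2 : nat).

Let trip_inj m : injective (@trip m).
Proof.
by move=> [[a b] c] [[a' b'] c'] [] /val_inj -> /val_inj -> /val_inj ->.
Qed.

Lemma box_sumE w g n m : (n <= m)%N -> (forall i j k, i + j + k <= w i j k)%N ->
  box_sum w g n = \sum_(p : 'I_m * 'I_m * 'I_m)
    (if (w p.1.1 p.1.2 p.2 < n)%N then g p.1.1 p.1.2 p.2 else 0).
Proof.
move=> nm wP.
have F0 i j k : (n <= i + j + k)%N ->
   (if (w i j k < n)%N then g i j k else 0) = 0.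
  by move=> h; rewrite ltnNge (leq_trans h (wP i j k)).
rewrite -(pair_bigA _ (fun (q : 'I_m * 'I_m) (k : 'I_m) =>
   if (w q.1 q.2 k < n)%N then g q.1 q.2 k else 0)) /=.
rewrite -(pair_bigA _ (fun (i : 'I_m) (j : 'I_m) =>
   \sum_(k < m) if (w i j k < n)%N then g i j k else 0)) /=.
rewrite /box_sum (sum_ord_widen (a := fun i => \sum_(j < n) \sum_(k < n)
  (if (w i j k < n)%N then g i j k else 0)) nm) => [|i ni]; last first.
  by apply: big1 => j _; apply: big1 => k _; apply: F0; lia.
apply: eq_bigr => i _.
rewrite (sum_ord_widen (a := fun j => \sum_(k < n)
  (if (w i j k < n)%N then g i j k else 0)) nm) => [|j nj]; last first.
  by apply: big1 => k _; apply: F0; lia.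
apply: eq_bigr => j _.
rewrite (sum_ord_widen (a := fun k => if (w i j k < n)%N then g i j k else 0) nm) // => k nk.
by apply: F0; lia.
Qed.

Let fset_bound (B : {fset nat * nat * nat}) : exists m, forall x, x \in B ->
  [&& x.1.1 < m, x.1.2 < m & x.2 < m]%N.
Proof.
exists (\max_(x <- B) (x.1.1 + x.1.2 + x.2)).+1 => x xB.
have := @leq_bigmax_seq _ (enum_fset B) xpredT (fun x => x.1.1 + x.1.2 + x.2)%N x xB isT.
by move=> h; apply/and3P; split; rewrite ltnS; apply: leq_trans h; lia.
Qed.

Let partial_sumE g (B : {fset nat * nat * nat}) m :
  (forall x, x \in B -> [&& x.1.1 < m, x.1.2 < m & x.2 < m]%N) ->
  summability.partial_sum (fun x : nat * nat * nat => g x.1.1 x.1.2 x.2) B =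
  \sum_(p : 'I_m * 'I_m * 'I_m)
    (if trip p \in B then g p.1.1 p.1.2 p.2 else 0).
Proof.
move=> Bm; rewrite /summability.partial_sum.
rewrite -(big_seq_fsetE _ B xpredT (fun x : nat * nat * nat => g x.1.1 x.1.2 x.2)) /=.
rewrite -big_mkcond.
pose s := [seq p <- index_enum ('I_m * 'I_m * 'I_m)%type | trip p \in B].
transitivity (\sum_(x <- map (@trip m) s) g x.1.1 x.1.2 x.2); last first.
  by rewrite big_map big_filter.
apply: perm_big; apply: uniq_perm.
- exact: fset_uniq.
- by rewrite (map_inj_uniq (@trip_inj m)) filter_uniq // index_enum_uniq.
move=> x; apply/idP/mapP => [xB|[p]]; last first.
  by rewrite mem_filter => /andP[pB _] ->.
have /and3P[x1 x2 x3] := Bm x xB.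
exists (Ordinal x1, Ordinal x2, Ordinal x3); rewrite ?mem_filter ?mem_index_enum ?andbT.
  by rewrite /trip /=; case: x xB {x1 x2 x3} => [[]].
by rewrite /trip /=; case: x {xB x1 x2 x3} => [[]].
Qed.

Lemma sum_half_exp3_le m (P : pred ('I_m * 'I_m * 'I_m)) :
  \sum_(p | P p) 2^-1 ^+ (p.1.1 + p.1.2 + p.2) <= 2 * 2 * 2 :> K.
Proof.
apply: (@le_trans _ _ (\sum_(p : 'I_m * 'I_m * 'I_m) 2^-1 ^+ (p.1.1 + p.1.2 + p.2))).
  rewrite [leRHS](bigID P) /= lerDl; apply: sumr_ge0 => p _.
  exact: half_exp_ge0.
rewrite -(pair_bigA _ (fun (q : 'I_m * 'I_m) (k : 'I_m) => 2^-1 ^+ (q.1 + q.2 + k))) /=.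
under eq_bigr do (under eq_bigr do rewrite exprD; rewrite -mulr_sumr).
rewrite -mulr_suml -(pair_bigA _ (fun (i : 'I_m) (j : 'I_m) => 2^-1 ^+ (i + j))) /=.
under eq_bigr do (under eq_bigr do rewrite exprD; rewrite -mulr_sumr).
have s0 : 0 <= \sum_(k < m) 2^-1 ^+ k :> K by apply: sumr_ge0 => k _; exact: half_exp_ge0.
by rewrite -mulr_suml; do 2?[apply: ler_pM; rewrite ?mulr_ge0 // ?sum_half_exp_le2].
Qed.

Lemma eq_box_sum w (f g : nat -> nat -> nat -> K) n :
  (forall i j k, f i j k = g i j k) -> box_sum w f n = box_sum w g n.
Proof.
by move=> fg; do 3![apply: eq_bigr => ? _]; rewrite fg.
Qed.

(** As the factor [F] and the cut depend only on i + j + 2k, the box sum is a linear functional of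
    the triple product and sees only its coefficients. *)
Lemma box_sum_cprod (F a b c d e : nat -> K) n :
  (forall m, cprod a (cprod b (dbl c)) m = cprod d (dbl e) m) ->
  box_sum (fun i j k => i + j + 2 * k)%N
    (fun i j k => F (i + j + 2 * k)%N * (a i * b j * c k)) n =
  \sum_(r < n) \sum_(s < n)
    (if (s + 2 * r < n)%N then F (s + 2 * r)%N * (d s * e r) else 0).
Proof.
move=> abc; pose G m := if (m < n)%N then F m else 0.
have G0 m : (n <= m)%N -> G m = 0 by rewrite /G leqNgt => /negPf ->.
transitivity (\sum_(m < n) G m * cprod a (cprod b (dbl c)) m).
  rewrite sum_cprod3_dbl //; do 3![apply: eq_bigr => ? _].
  by rewrite /G; case: ifP; rewrite ?mul0r.
under eq_bigr do rewrite abc.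
rewrite sum_cprod_dbl // exchange_big; do 2![apply: eq_bigr => ? _].
by rewrite /G; case: ifP; rewrite ?mul0r.
Qed.

(** Of the two powers of 1/2 in the bound, one makes the part of weight at least n small, and the
    other is summable over all triples because w >= i + j + k. *)
Lemma has_sum3_box w g C (l : K) : (forall i j k, i + j + k <= w i j k)%N ->
  (forall i j k, `|g i j k| <= C * (2^-1 * 2^-1) ^+ w i j k) ->
  box_sum w g n @[n --> \oo] --> l -> has_sum3 g l.
Proof.
move=> wP gC gl; rewrite /has_sum3; apply/cvgrPdist_lt => e e0.
have C0 : 0 <= C.
  have := le_trans (normr_ge0 _) (gC 0%N 0%N 0%N).
  by rewrite pmulr_lge0 // exprn_gt0 // mulr_gt0.
have e2 : 0 < e / 2 by rewrite divr_gt0 // ltr0n.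
have [n _ /(_ n (leqnn n)) /= [Sn Cn]] : \forall n \near \oo,
    `|l - box_sum w g n| < e / 2 /\ C * (2 * 2 * 2) * 2^-1 ^+ n < e / 2.
  apply: filterI; first by move/cvgrPdist_lt : gl; exact.
  by apply: half_exp_lt => //; rewrite !mulr_ge0.
(* [A] contains every triple of weight below [n], so for [B] containing [A] the remainder involves
   only weights at least [n]. *)
pose A : {fset nat * nat * nat} := [fset trip p | p in [set: 'I_n * 'I_n * 'I_n]%SET]%fset.
exists A => //= B AB.
have [m0 Bm0] := fset_bound B; pose m := maxn m0 n.
have Bm x : x \in B -> [&& x.1.1 < m, x.1.2 < m & x.2 < m]%N.
  by move=> /Bm0; lia.
have nm : (n <= m)%N by rewrite leq_maxr.
have mem_B (p : 'I_m * 'I_m * 'I_m) : (w p.1.1 p.1.2 p.2 < n)%N -> @trip m p \in B.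
  move=> wn; apply: (fsubsetP AB); have := wP p.1.1 p.1.2 p.2 => wp.
  have x1 : (p.1.1 < n)%N by lia.
  have x2 : (p.1.2 < n)%N by lia.
  have x3 : (p.2 < n)%N by lia.
  by apply/imfsetP; exists (Ordinal x1, Ordinal x2, Ordinal x3); rewrite ?inE.
rewrite (partial_sumE _ Bm).
have -> : l - \sum_(p : 'I_m * 'I_m * 'I_m) (if trip p \in B then g p.1.1 p.1.2 p.2 else 0) =
   (l - box_sum w g n) - \sum_(p : 'I_m * 'I_m * 'I_m |
      (trip p \in B) && (n <= w p.1.1 p.1.2 p.2)%N) g p.1.1 p.1.2 p.2.
  rewrite (box_sumE g nm wP) -addrA -opprD; congr (_ - _).
  rewrite [X in _ = _ + X]big_mkcond -big_split; apply: eq_bigr => p _ /=.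
  case: ltnP => [/mem_B -> /=|_]; first by rewrite addr0.
  by rewrite andbT add0r.
rewrite [e]splitr; apply: le_lt_trans (ler_normB _ _) _; apply: ltr_leD => //.
apply: le_trans (ler_norm_sum _ _ _) (le_trans _ (ltW Cn)).
apply: (@le_trans _ _ (\sum_(p : 'I_m * 'I_m * 'I_m |
      (trip p \in B) && (n <= w p.1.1 p.1.2 p.2)%N)
        C * 2^-1 ^+ n * 2^-1 ^+ (p.1.1 + p.1.2 + p.2))).
  apply: ler_sum => p /andP[_ np]; apply: le_trans (gC _ _ _) _.
  rewrite -mulrA ler_wpM2l // exprMn.
  have le21 : 2^-1 <= 1 :> K by rewrite invf_le1 // ler1n.
  by apply: ler_pM; rewrite ?half_exp_ge0 // ler_wiXn2l // invr_ge0.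
by rewrite -mulr_sumr [leRHS]mulrAC ler_wpM2l ?sum_half_exp3_le // mulr_ge0 // half_exp_ge0.
Qed.

End BoxSums.

(** * Euler's expansion and infinite q-products *)

Context (complK : forall (a : nat -> K) M,
  (forall n, `|a n| <= M * 2^-1 ^+ n) ->
  exists l : K, \sum_(k < n) a k @[n --> \oo] --> l).

Lemma onem_norm_le (p : K) n : `|p| < 1 -> 1 - `|p| <= `|1 - p ^+ n.+1|.
Proof.
move=> p1; apply: le_trans (lerB_dist _ _); rewrite normr1 lerD2l lerN2.
by rewrite normrX exprS ler_piMr // exprn_ile1 // ltW.
Qed.

Lemma norm_invqf_le (p : K) n : `|p| < 1 -> `|invqf p n| <= (1 - `|p|)^-1 ^+ n.
Proof.
move=> p1; have p0 : 0 < 1 - `|p| by rewrite subr_gt0.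
elim: n => [|n IHn]; first by rewrite invqf0 normr1.
rewrite -(ler_pM2l p0) exprS mulrA mulfV ?gt_eqF // mul1r.
apply: le_trans IHn; rewrite -(invqfS n p1) normrM ler_wpM2r //.
exact: onem_norm_le.
Qed.

Lemma euler_bound (p : K) y (z : K) : `|p| < 1 -> 0 < z ->
  exists C, 0 <= C /\
    forall n, `|p ^+ 'C(n, 2) * y ^+ n * invqf p n| <= C * z ^+ n.
Proof.
move=> p1 z0; have p0 : 0 < 1 - `|p| by rewrite subr_gt0.
have [||C [C0 HC]] := @super_geometric_bound_geom `|p|
   (`|y| * (1 - `|p|)^-1) z _ _ z0; first by rewrite normr_ge0.
  by rewrite mulr_ge0 // invr_ge0 ltW.
exists C; split=> // n; apply: le_trans (HC n).
by rewrite !normrM !normrX exprMn mulrA ler_wpM2l ?norm_invqf_le.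
Qed.

(** The quotient (p;p)_n / (p;p)_(n-k) from the finite q-binomial theorem, extended by 0 to k > n.
    It is at most 2^k in norm and tends to 1 with n. *)
Let ratio (p : K) n k := if (k <= n)%N then qpoch p p n * invqf p (n - k) else 0.

Let ratioS (p : K) n k : `|p| < 1 -> ratio p n k.+1 = ratio p n k * (1 - p ^+ (n - k)).
Proof.
move=> p1; rewrite /ratio; case: (ltngtP k n) => kn.
- by rewrite -mulrA; congr (_ * _); rewrite [RHS]mulrC -(subnSK kn) invqfS.
- by rewrite mul0r.
- by rewrite kn subnn subrr mulr0.
Qed.

Let norm_ratio (p : K) n k : `|p| < 1 -> `|ratio p n k| <= 2 ^+ k.
Proof.
move=> p1; elim: k => [|k IHk].
  by rewrite /ratio subn0 /invqf mulfV ?qpoch_neq0 // normr1.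
rewrite ratioS // normrM exprSr ler_pM //.
apply: le_trans (ler_normB _ _) _; rewrite normr1 normrX.
by rewrite -[2]/(1 + 1) lerD2l exprn_ile1 // ltW.
Qed.

Let cvg_ratio (p : K) k : `|p| < 1 -> ratio p n k @[n --> \oo] --> (1 : K).
Proof.
move=> p1; elim: k => [|k IHk].
  under eq_fun do rewrite /ratio subn0 /invqf mulfV ?qpoch_neq0 //.
  exact: cvg_cst.
under eq_fun do rewrite ratioS //.
have p0 : p ^+ (n - k) @[n --> \oo] --> (0 : K).
  by rewrite (cvg_centern k (fun n => p ^+ n)); exact: geomK.
have := cvgM IHk (cvgB (cvg_cst (1 : K)) p0).
by rewrite subr0 mulr1; apply.
Qed.

Let qpoch_sum (p : K) y n : `|p| < 1 -> qpoch (- y) p n =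
  \sum_(k < n.+1) ratio p n k * (p ^+ 'C(k, 2) * y ^+ k * invqf p k).
Proof.
move=> p1; have := cauchy_binomial y n p1.
move/(congr1 ( *%R (qpoch p p n))); rewrite [RHS]mulrCA mulfV ?qpoch_neq0 // mulr1.
move=> <-; rewrite cprodC mulr_sumr; apply: eq_bigr => k _.
by rewrite /ratio -ltnS ltn_ord mulrCA mulrC -mulrA mulrCA mulrA.
Qed.

(** Letting n tend to infinity in the finite q-binomial theorem by [tannery]; convergence of the
    product is deduced from that of the series. *)
Lemma euler_cvg (p : K) y : `|p| < 1 ->
  exists l : K, \sum_(k < n) p ^+ 'C(k, 2) * y ^+ k * invqf p k @[n --> \oo] --> l /\
    qpoch (- y) p n @[n --> \oo] --> l.
Proof.
(* Ratio 1/4, since the bound 2^k on [ratio] must leave a factor 2^-k. *)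
move=> p1; have [||C [C0 HC]] := @euler_bound p y (2^-1 * 2^-1) => //.
have [|l sl] := @complK (fun k => p ^+ 'C(k, 2) * y ^+ k * invqf p k) C.
  move=> n; apply: le_trans (HC n) _; rewrite ler_wpM2l // exprMn.
  rewrite ler_piMl ?half_exp_ge0 // exprn_ile1 ?invr_ge0 ?ler0n //.
  by rewrite invf_le1 ?ltr0n // ler1n.
exists l; split => //; under eq_fun do rewrite qpoch_sum //.
apply: (@tannery (fun n k => ratio p n k * (p ^+ 'C(k, 2) * y ^+ k * invqf p k))
  (fun k => p ^+ 'C(k, 2) * y ^+ k * invqf p k) C) => //.
  move=> n k; rewrite normrM; apply: (@le_trans _ _ (2 ^+ k * (C * (2^-1 * 2^-1) ^+ k))).
    by apply: ler_pM => //; exact: norm_ratio.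
  rewrite mulrCA -exprMn mulrA mulfV ?mul1r // pnatr_eq0 //.
move=> k; rewrite -[X in _ --> X]mul1r; apply: cvgM; first exact: cvg_ratio.
exact: cvg_cst.
Qed.

Lemma cvg_qpoch (p : K) y : `|p| < 1 -> qpoch y p n @[n --> \oo] --> qpoch_inf y p.
Proof.
move=> p1; have [l [_]] := @euler_cvg p (- y) p1; rewrite opprK => yl.
by rewrite /qpoch_inf (cvg_lim _ yl).
Qed.

Lemma euler_sum (p : K) y : `|p| < 1 ->
  \sum_(k < n) p ^+ 'C(k, 2) * y ^+ k * invqf p k @[n --> \oo] --> qpoch_inf (- y) p.
Proof.
move=> p1; have [l [? yl]] := @euler_cvg p y p1.
by rewrite /qpoch_inf (cvg_lim _ yl).
Qed.

Let cvgq y (p : K) (p1 : `|p| < 1) : qpoch y p n @[n --> \oo] --> qpoch_inf y p.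
Proof. exact: cvg_qpoch. Qed.
Arguments cvgq y [p] p1.

Lemma cvg_seq_unique (u : nat -> K) (a b : K) :
  u n @[n --> \oo] --> a -> u n @[n --> \oo] --> b -> a = b.
Proof. exact: cvg_unique. Qed.

Lemma qpochD y (p : K) n m : qpoch y p (n + m) = qpoch y p n * qpoch (y * p ^+ n) p m.
Proof.
rewrite /qpoch big_split_ord /=; congr (_ * _).
by apply: eq_bigr => k _; rewrite exprD mulrA.
Qed.

Lemma qpoch_inf_shift y (p : K) n : `|p| < 1 ->
  qpoch_inf y p = qpoch y p n * qpoch_inf (y * p ^+ n) p.
Proof.
move=> p1; apply: (@cvg_seq_unique (fun m => qpoch y p (m + n)%N)).
  by have := cvgq y p1; rewrite -(cvg_shiftn n (qpoch y p)); apply.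
under eq_fun do rewrite addnC qpochD.
by apply: cvgM; [exact: cvg_cst|exact: cvgq].
Qed.

Lemma qpoch_inf_sqr y (p : K) : `|p| < 1 ->
  qpoch_inf y p * qpoch_inf (- y) p = qpoch_inf (y ^+ 2) (p ^+ 2).
Proof.
move=> p1; have p21 : `|p ^+ 2| < 1 by exact: norm_expr_lt1.
apply: (@cvg_seq_unique (qpoch (y ^+ 2) (p ^+ 2))); last exact: cvgq.
have -> : qpoch (y ^+ 2) (p ^+ 2) = (fun n => qpoch y p n * qpoch (- y) p n).
  apply/funext => n; rewrite /qpoch -big_split; apply: eq_bigr => k _ /=.
  by rewrite exprAC; ring.
by apply: cvgM; exact: cvgq.
Qed.

Lemma qpoch_inf_parity y (p : K) : `|p| < 1 ->
  qpoch_inf y p = qpoch_inf y (p ^+ 2) * qpoch_inf (y * p) (p ^+ 2).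
Proof.
move=> p1; have p21 : `|p ^+ 2| < 1 by exact: norm_expr_lt1.
have cvg_double : (fun n => n.*2) @ \oo --> \oo.
  by move=> A [N _ NA]; exists N => // n /= Nn; apply: NA => /=; lia.
apply: (@cvg_seq_unique (fun n => qpoch y p n.*2)).
  by apply: cvg_trans (cvgq y p1); apply: (cvg_app (qpoch y p)) cvg_double.
have -> : (fun n => qpoch y p n.*2) = (fun n => qpoch y (p ^+ 2) n * qpoch (y * p) (p ^+ 2) n).
  apply/funext; elim=> [|n IHn]; first by rewrite !qpoch0 mulr1.
  by rewrite doubleS !qpochS IHn [p ^+ _.*2.+1]exprS -mul2n exprM; ring.
by apply: cvgM; exact: cvgq.
Qed.

(** With c = 1/(1 - |p|), each factor satisfies 1/|1 - p^k| <= 1 + c |p|^k for k >= 1. The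
    reciprocals are thus dominated by a convergent product. *)
Let norm_invqf_le_qpoch (p : K) n : `|p| < 1 ->
  `|invqf p n| <= qpoch (- ((1 - `|p|)^-1 * `|p|)) `|p| n.
Proof.
move=> p1; have p0 : 0 < 1 - `|p| by rewrite subr_gt0.
set c := _^-1; have c0 : 0 <= c by rewrite invr_ge0 ltW.
elim: n => [|n IHn]; first by rewrite invqf0 qpoch0 normr1.
rewrite qpochS /invqf qpochS -/(invqf p n) invfM normrM; apply: ler_pM => //.
rewrite -exprS mulNr opprK normfV.
have z0 : 0 < `|1 - p ^+ n.+1| by rewrite normr_gt0 onem_exprS_neq0.
rewrite -[_^-1]mul1r ler_pdivrMr //.
have le_z := onem_norm_le n p1.
have le_t : 1 - `|p| ^+ n.+1 <= `|1 - p ^+ n.+1|.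
  by apply: le_trans (lerB_dist _ _); rewrite normr1 normrX.
rewrite -[c * _ * _]mulrA -exprS mulrDl mul1r.
apply: (@le_trans _ _ (1 - `|p| ^+ n.+1 + `|p| ^+ n.+1)); first by rewrite subrK.
apply: lerD => //; rewrite mulrAC -[leLHS]mul1r ler_wpM2r ?exprn_ge0 //.
by rewrite -[leLHS](mulVf (lt0r_neq0 p0)) ler_wpM2l.
Qed.

(** Bounded reciprocals keep (p;p)_n away from 0. *)
Lemma qpoch_inf_neq0 (p : K) : `|p| < 1 -> qpoch_inf p p != 0.
Proof.
move=> p1; apply/negP => /eqP q0.
have pp1 : `| `|p| | < 1 by rewrite normr_id.
have := cvgq (- ((1 - `|p|)^-1 * `|p|)) pp1; set l := qpoch_inf _ _ => ul.
have B0 : 0 < `|l| + 1 by rewrite ltr_wpDl.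
have := cvgq p p1; rewrite q0 => /cvgrPdist_lt /(_ (`|l| + 1)^-1).
rewrite invr_gt0 => /(_ B0) small.
have lB : `|l| < `|l| + 1 by rewrite ltrDl.
have [n _ /(_ n (leqnn n)) /= [h1 h2]] := filterI small (cvgr_norm_le _ ul _ lB).
have inv_le := norm_invqf_le_qpoch n p1.
move: h1; rewrite sub0r normrN le_gtF //.
rewrite -[_^-1]mul1r ler_pdivrMr //.
apply: (@le_trans _ _ (`|qpoch p p n| * `|invqf p n|)).
  by rewrite -normrM mulfV ?normr1 // qpoch_neq0.
rewrite ler_wpM2l //; apply: (le_trans inv_le).
by rewrite -(ger0_norm (le_trans (normr_ge0 _) inv_le)).
Qed.

(** * The three triple series *)

Section TripleSeries.
Context (q : K) (q1 : `|q| < 1).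

Let q21 : `|q ^+ 2| < 1. Proof. exact: norm_expr_lt1. Qed.
Let q41 : `|q ^+ 4| < 1. Proof. exact: norm_expr_lt1. Qed.
Let q81 : `|q ^+ 8| < 1. Proof. exact: norm_expr_lt1. Qed.

Lemma norm_invqf_expr_le m n :
  `|invqf (q ^+ m.+1) n| <= (1 - `|q|)^-1 ^+ n.
Proof.
apply: le_trans (norm_invqf_le n (norm_expr_lt1 m q1)) _.
have le_q : `|q ^+ m.+1| <= `|q|.
  by rewrite normrX exprS ler_piMr // exprn_ile1 // ltW.
have p0 : 0 < 1 - `|q| by rewrite subr_gt0.
have pm0 : 0 < 1 - `|q ^+ m.+1| by rewrite subr_gt0 norm_expr_lt1.
rewrite lerXn2r ?nnegrE ?invr_ge0 ?(ltW p0) ?(ltW pm0) //.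
by rewrite lef_pV2 ?posrE // lerD2l lerN2.
Qed.

(** All exponents are compared with N = i + j + 2k, so that one bound serves the three series:
    |q|^C(N,2) absorbs every geometric growth in N. *)
Lemma triple_bound (u : K) : exists C, forall i j k E F w,
  ('C(i + j + 2 * k, 2) <= E)%N -> (F <= 2 * (i + j + 2 * k))%N ->
  (w <= 2 * (i + j + 2 * k))%N ->
  `|q ^+ E * u ^+ F * (invqf q i * invqf (q ^+ 2) j * invqf (q ^+ 4) k)| <=
  C * (2^-1 * 2^-1) ^+ w.
Proof.
pose d := (1 - `|q|)^-1; pose U := 1 + `|u|.
have p0 : 0 < 1 - `|q| by rewrite subr_gt0.
have d1 : 1 <= d by rewrite invf_ge1 // gerBl.
have U1 : 1 <= U by rewrite lerDl.
have h0 : 0 <= 2^-1 * 2^-1 :> K by rewrite mulr_ge0 // invr_ge0.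
have h1 : 2^-1 * 2^-1 <= 1 :> K.
  by rewrite mulr_ile1 ?invr_ge0 // invf_le1 // ler1n.
have d0 := le_trans ler01 d1; have U0 := le_trans ler01 U1.
(* The squares of U and of 1/4 come from F <= 2N and w <= 2N; d^N covers the three reciprocals, as i
   + j + k <= N. *)
have [||| C [C0 HC]] := @super_geometric_bound_geom `|q| (U ^+ 2 * d) ((2^-1 * 2^-1) ^+ 2).
- by rewrite normr_ge0.
- by rewrite mulr_ge0 // exprn_ge0.
- by rewrite exprn_gt0 // mulr_gt0.
exists C => i j k E F w; set N := (i + j + 2 * k)%N => NE FN wN.
apply: (@le_trans _ _ (`|q| ^+ 'C(N, 2) * (U ^+ 2 * d) ^+ N)); last first.
  apply: le_trans (HC N) _; rewrite ler_wpM2l // -exprM.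
  by rewrite ler_wiXn2l.
rewrite !normrM !normrX exprMn [leRHS]mulrA; apply: ler_pM; rewrite ?mulr_ge0 ?exprn_ge0 //.
  apply: ler_pM; rewrite ?exprn_ge0 //.
    by rewrite ler_wiXn2l // ltW.
  rewrite -exprM; apply: (@le_trans _ _ (U ^+ F)).
    by rewrite lerXn2r ?nnegrE // lerDr.
  by rewrite ler_weXn2l.
apply: (@le_trans _ _ (d ^+ i * d ^+ j * d ^+ k)).
  do 2?[apply: ler_pM; rewrite ?mulr_ge0 //].
  - exact: norm_invqf_le.
  - exact: norm_invqf_expr_le.
  - exact: norm_invqf_expr_le.
by rewrite -!exprD ler_weXn2l //; rewrite /N; lia.
Qed.

(** Exact for every [n]: the weight is the exponent of [u], so the cut truncates a power series in
    [u]. First j and k collapse into m = j + 2k, then i and 2m into s = i + 2m. *)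
Lemma box_sum_euler (u : K) n :
  box_sum (fun i j k => i + 2 * j + 4 * k)%N
    (fun i j k => (-1) ^+ k
       * q ^+ ((i + j + 2 * k) * (i + j + 2 * k - 1) + j + 2 * k ^ 2)
       * u ^+ (i + 2 * j + 4 * k)
       / (qpoch q q i * qpoch (q ^+ 2) (q ^+ 2) j * qpoch (q ^+ 4) (q ^+ 4) k)) n =
  \sum_(s < n) q ^+ 'C(s, 2) * u ^+ s * invqf q s.
Proof.
pose H i m := q ^+ ((i + m) * (i + m - 1)) * u ^+ (i + 2 * m) * invqf q i.
pose e2 m := q ^+ (m ^ 2) * invqf (q ^+ 2) m.
transitivity (\sum_(i < n) \sum_(m < n) (if (i + 2 * m < n)%N then H i m else 0) * e2 m).
  apply: eq_bigr => i _.
  transitivity (\sum_(m < n) (if (i + 2 * m < n)%N then H i m else 0) *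
     cprod (fun j => q ^+ j * invqf (q ^+ 2) j)
       (dbl (fun k => (-1) ^+ k * q ^+ (2 * k ^ 2) * invqf (q ^+ 4) k)) m); last first.
    by apply: eq_bigr => m _; rewrite cprod_invqf_dbl_alt.
  rewrite (sum_cprod_dbl
    (F := fun m => if (i + 2 * m < n)%N then H i m else 0)) => [|m nm]; last first.
    by rewrite ifF //; lia.
  apply: eq_bigr => j _; apply: eq_bigr => k _.
  rewrite (_ : (i + 2 * (j + 2 * k) = i + 2 * j + 4 * k)%N); last by lia.
  case: ifP => _; last by rewrite mul0r.
  rewrite /H !invfM -!/(invqf _ _) ![(i + (j + 2 * k))%N]addnA.
  rewrite (_ : (i + 2 * (j + 2 * k) = i + 2 * j + 4 * k)%N); last by lia.
  by rewrite !exprD; ring.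
(* Spreading m to l = 2m turns the weight into i + l, as [sum_triangle] requires. *)
transitivity (\sum_(i < n) \sum_(l < n) (if (i + l < n)%N then
     H i l./2 * dbl e2 l else 0)).
  apply: eq_bigr => i _.
  transitivity (\sum_(l < n) (if (i + l < n)%N then H i l./2 else 0) * dbl e2 l); last first.
    by apply: eq_bigr => l _; case: ifP; rewrite ?mul0r.
  rewrite (sum_dbl e2
    (F := fun l => if (i + l < n)%N then H i l./2 else 0)) => [|l nl]; last first.
    by rewrite ifF //; lia.
  by apply: eq_bigr => m _; rewrite doubleK mul2n.
rewrite -(sum_triangle (fun i l => H i l./2 * dbl e2 l)).
apply: eq_bigr => s _; rewrite mulrAC -sum_invqf_triangle // mulr_suml.
apply: eq_bigr => i _; rewrite /H /dbl; case: ifP => si.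
  by rewrite !mulr0 mul0r.
have -> : (i + 2 * (s - i)./2 = s)%N.
  by have := ltn_ord i; move: si; lia.
by rewrite /e2; ring.
Qed.

Lemma has_sum3_euler (u : K) :
  has_sum3
    (fun i j k : nat => (-1) ^+ k
       * q ^+ ((i + j + 2 * k) * (i + j + 2 * k - 1) + j + 2 * k ^ 2)
       * u ^+ (i + 2 * j + 4 * k)
       / (qpoch q q i * qpoch (q ^+ 2) (q ^+ 2) j * qpoch (q ^+ 4) (q ^+ 4) k))
    (qpoch_inf (- u) q).
Proof.
have [C HC] := triple_bound u.
apply: (@has_sum3_box (fun i j k => i + 2 * j + 4 * k)%N _ C) => [i j k|i j k|].
- by lia.
- rewrite -2!mulrA normrM normrX normrN1 expr1n mul1r mulrA !invfM -!/(invqf _ _).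
  apply: HC; [|lia|lia].
  by have := bin2_sqr (i + j + 2 * k); rewrite mulnBr muln1 mulnn; lia.
under eq_fun do rewrite box_sum_euler.
exact: euler_sum.
Qed.


(* [(-q^2;q^2)_oo = (-q^2;q^4)_r (-q^4;q^4)_r (-q^(4r+2);q^2)_oo] and
   [(q^4;q^4)_r (-q^4;q^4)_r = (q^8;q^8)_r]. *)
Lemma qpoch_inf_invqf r :
  qpoch (- q ^+ 2) (q ^+ 4) r * invqf (q ^+ 4) r *
    qpoch_inf (- q ^+ (4 * r + 2)) (q ^+ 2) =
  qpoch_inf (- q ^+ 2) (q ^+ 2) * invqf (q ^+ 8) r.
Proof.
have split_even n : qpoch (- q ^+ 2) (q ^+ 2) (2 * n) =
    qpoch (- q ^+ 2) (q ^+ 4) n * qpoch (- q ^+ 4) (q ^+ 4) n.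
  elim: n => [|n IHn]; first by rewrite !qpoch0 mulr1.
  rewrite mulnS !qpochS IHn -!exprM !mulNr !opprK -!exprD.
  rewrite (_ : 2 + 2 * (2 * n) = 2 + 4 * n)%N; last by lia.
  rewrite (_ : 2 + 2 * (2 * n).+1 = 4 + 4 * n)%N; last by lia.
  by ring.
have prod8 n : qpoch (q ^+ 4) (q ^+ 4) n * qpoch (- q ^+ 4) (q ^+ 4) n =
    qpoch (q ^+ 8) (q ^+ 8) n.
  rewrite /qpoch -big_split; apply: eq_bigr => k _ /=.
  rewrite -!exprM -!exprD mulNr opprK -exprD.
  by rewrite (_ : 8 + 8 * k = (4 + 4 * k) + (4 + 4 * k))%N ?exprD; [ring|lia].
have inv8 : invqf (q ^+ 4) r = qpoch (- q ^+ 4) (q ^+ 4) r * invqf (q ^+ 8) r.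
  have := qpoch_neq0 r q81; rewrite /invqf -prod8 mulf_eq0 negb_or => /andP[P0 B0].
  by rewrite invfM mulrCA mulfV ?mulr1.
rewrite (qpoch_inf_shift (- q ^+ 2) (2 * r) q21) split_even inv8.
have -> : - q ^+ 2 * q ^+ 2 ^+ (2 * r) = - q ^+ (4 * r + 2).
  by rewrite -exprM mulNr -exprD; congr (- _ ^+ _); lia.
by ring.
Qed.

(** The second series is y = q^4 and the third is y = 1. For fixed r the sum over s is Euler's;
    [tannery] then governs the sum over r. *)
Lemma double_sum_cvg (y : K) : `|y| <= 1 ->
  \sum_(r < n.+1) \sum_(s < n.+1) (if (s + 2 * r < n.+1)%N then
     (q ^+ (4 * r ^ 2) * y ^+ r *
       (qpoch (- q ^+ 2) (q ^+ 4) r * invqf (q ^+ 4) r)) *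
     ((q ^+ 2) ^+ 'C(s, 2) * (q ^+ (4 * r + 2)) ^+ s * invqf (q ^+ 2) s) else 0)
   @[n --> \oo] -->
  qpoch_inf (- q ^+ 2) (q ^+ 2) * qpoch_inf (- (q ^+ 4 * y)) (q ^+ 8).
Proof.
move=> y1.
pose c r := q ^+ (4 * r ^ 2) * y ^+ r * (qpoch (- q ^+ 2) (q ^+ 4) r * invqf (q ^+ 4) r).
pose t r s := (q ^+ 2) ^+ 'C(s, 2) * (q ^+ (4 * r + 2)) ^+ s * invqf (q ^+ 2) s.
pose T r n := \sum_(s < n) (if (s + 2 * r < n)%N then t r s else 0).
have [|C [C0 HC]] := @euler_bound (q ^+ 2) 1 2^-1 q21; first by rewrite invr_gt0.
(* The 2 accounts for the bound 2^r on (-q^2;q^4)_r. *)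
have [|D [D0 HD]] := @euler_bound (q ^+ 4) 2 2^-1 q41; first by rewrite invr_gt0.
have tC r s : `|t r s| <= C * 2^-1 ^+ s.
  apply: le_trans (HC s); rewrite /t !normrM expr1n normr1 mulr1 ler_wpM2r //.
  by rewrite ler_piMr // normrX exprn_ile1 // normrX exprn_ile1 // ltW.
have TC r n : `|T r n| <= C * 2.
  apply: le_trans (ler_norm_sum _ _ _) _.
  apply: (@le_trans _ _ (\sum_(s < n) C * 2^-1 ^+ s)).
    apply: ler_sum => s _; case: ifP => _; first exact: tC.
    by rewrite normr0 mulr_ge0 ?half_exp_ge0.
  by rewrite -mulr_sumr ler_wpM2l // sum_half_exp_le2.
have cD r : `|c r| <= D * 2^-1 ^+ r.
  apply: le_trans (HD r); rewrite /c !normrM mulrA ler_wpM2r //.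
  rewrite -mulrA; apply: ler_pM => //.
    rewrite -exprM !normrX ler_wiXn2l ?(ltW q1) //.
    by rewrite bin2_sqr; lia.
  apply: (@le_trans _ _ (1 * 2 ^+ r)); last by rewrite mul1r normrX normr_nat.
  apply: ler_pM => //; first by rewrite normrX exprn_ile1.
  elim: r => [|r IHr]; first by rewrite qpoch0 normr1.
  rewrite qpochS normrM [leRHS]exprSr; apply: ler_pM => //; rewrite mulNr opprK.
  apply: le_trans (ler_normD _ _) _; rewrite normr1 -[2]/(1 + 1) lerD2l.
  by rewrite -exprM -exprD normrX exprn_ile1 // ltW.
have -> : (fun n => \sum_(r < n.+1) \sum_(s < n.+1) (if (s + 2 * r < n.+1)%N then
   c r * t r s else 0)) = (fun n => \sum_(r < n.+1) c r * T r n.+1).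
  apply/funext => n; apply: eq_bigr => r _; rewrite mulr_sumr; apply: eq_bigr => s _.
  by case: ifP => // _; rewrite mulr0.
apply: (@tannery (fun n r => c r * T r n.+1)
  (fun r => c r * qpoch_inf (- q ^+ (4 * r + 2)) (q ^+ 2)) (D * (C * 2))).
- by move=> n r; rewrite normrM mulrAC; apply: ler_pM.
- move=> r; apply: cvgM; first exact: cvg_cst.
  (* The cut s + 2r < n only delays the Euler partial sum by 2r. *)
  have TE n : T r n = \sum_(s < n - 2 * r) t r s.
    rewrite /T -(sum_ord_widen
      (a := fun s => if (s + 2 * r < n)%N then t r s else 0) (leq_subr (2 * r) n)).
      by apply: eq_bigr => s _; rewrite ifT //; have := ltn_ord s; lia.
    by move=> s ns; rewrite ifF //; lia.
  suff : T r n @[n --> \oo] --> qpoch_inf (- q ^+ (4 * r + 2)) (q ^+ 2).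
    by rewrite -cvg_shiftS; apply.
  under eq_fun do rewrite TE.
  have := @euler_sum _ (q ^+ (4 * r + 2)) q21.
  by rewrite -(cvg_centern (2 * r)); apply.
have -> : (fun n => \sum_(r < n) c r * qpoch_inf (- q ^+ (4 * r + 2)) (q ^+ 2)) =
  (fun n => qpoch_inf (- q ^+ 2) (q ^+ 2) *
     \sum_(r < n) (q ^+ 8) ^+ 'C(r, 2) * (q ^+ 4 * y) ^+ r * invqf (q ^+ 8) r).
  apply/funext => n; rewrite mulr_sumr; apply: eq_bigr => r _.
  rewrite /c -mulrA qpoch_inf_invqf [(_ * y) ^+ _]exprMn -!exprM.
  have -> : (4 * r ^ 2 = 8 * 'C(r, 2) + 4 * r)%N by rewrite bin2_sqr; lia.
  by rewrite exprD; ring.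
by apply: cvgM; [exact: cvg_cst|exact: euler_sum].
Qed.

Let sum_bound (E : nat -> nat -> nat -> nat) (l : K) :
  (forall i j k, 'C(i + j + 2 * k, 2) <= E i j k)%N ->
  box_sum (fun i j k => i + j + 2 * k)%N
    (fun i j k => (-1) ^+ j * q ^+ E i j k
       / (qpoch q q i * qpoch (q ^+ 2) (q ^+ 2) j * qpoch (q ^+ 4) (q ^+ 4) k)) n
    @[n --> \oo] --> l ->
  has_sum3 (fun i j k => (-1) ^+ j * q ^+ E i j k
     / (qpoch q q i * qpoch (q ^+ 2) (q ^+ 2) j * qpoch (q ^+ 4) (q ^+ 4) k)) l.
Proof.
move=> hE; have [C HC] := triple_bound 1.
apply: (@has_sum3_box _ _ C) => [i j k|i j k]; first by lia.
rewrite -mulrA normrM normrX normrN1 expr1n mul1r !invfM -!/(invqf _ _).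
have := HC i j k (E i j k) 0%N (i + j + 2 * k)%N.
by rewrite expr0 mulr1; apply; rewrite // leq_pmull.
Qed.

Let prod_parity y (p : K) (p1 : `|p| < 1) := @qpoch_inf_parity y p p1.
Let prod_sqr y (p : K) (p1 : `|p| < 1) := @qpoch_inf_sqr y p p1.

(** Multiplying by (q^2;q^2)_oo gives (q^4;q^4)_oo = (q^4;q^8)_oo (q^8;q^8)_oo. The last factor
    merges with (-q^8;q^8)_oo into (q^16;q^16)_oo, and (q^4;q^8)_oo splits modulo 16. *)
Lemma qpoch_inf_quotient_second :
  qpoch_inf (- q ^+ 2) (q ^+ 2) * qpoch_inf (- (q ^+ 4 * q ^+ 4)) (q ^+ 8) =
  qpoch_inf_seq [:: q ^+ 4; q ^+ 12; q ^+ 16] (q ^+ 16)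
    / qpoch_inf (q ^+ 2) (q ^+ 2).
Proof.
apply: (mulIf (qpoch_inf_neq0 q21)); rewrite mulfVK ?qpoch_inf_neq0 //.
have E1 := prod_sqr (q ^+ 2) q21.
have E2 := prod_parity (q ^+ 4) q41.
have E3 := prod_sqr (q ^+ 8) q81.
have E4 := prod_parity (q ^+ 4) q81.
rewrite -!exprM -?exprD in E1 E2 E3 E4.
rewrite -exprD mulrAC [_ * qpoch_inf (q ^+ 2) _]mulrC E1 E2 -mulrA E3 E4.
by rewrite /qpoch_inf_seq !big_cons big_nil mulr1 mulrA.
Qed.

(** After (q^4;q^4)_oo = (q^4;q^8)_oo (q^8;q^8)_oo, the factor (q^4;q^8)_oo (-q^4;q^8)_oo =
    (q^8;q^16)_oo combines with (q^16;q^16)_oo into a second (q^8;q^8)_oo. *)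
Lemma qpoch_inf_quotient_third :
  qpoch_inf (- q ^+ 2) (q ^+ 2) * qpoch_inf (- (q ^+ 4 * 1)) (q ^+ 8) =
  qpoch_inf (q ^+ 8) (q ^+ 8) ^+ 2
    / (qpoch_inf (q ^+ 2) (q ^+ 2) * qpoch_inf (q ^+ 16) (q ^+ 16)).
Proof.
have q161 : `|q ^+ 16| < 1 by exact: norm_expr_lt1.
have n0 : qpoch_inf (q ^+ 2) (q ^+ 2) * qpoch_inf (q ^+ 16) (q ^+ 16) != 0.
  by rewrite mulf_neq0 ?qpoch_inf_neq0.
apply: (mulIf n0); rewrite mulfVK //.
have E1 := prod_sqr (q ^+ 2) q21.
have E2 := prod_parity (q ^+ 4) q41.
have E3 := prod_sqr (q ^+ 4) q81.
have E4 := prod_parity (q ^+ 8) q81.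
rewrite -!exprM -?exprD in E1 E2 E3 E4.
rewrite mulr1; set x := qpoch_inf (- q ^+ 2) _ in E1 *.
rewrite [LHS](_ : _ = qpoch_inf (q ^+ 2) (q ^+ 2) * x *
  qpoch_inf (- q ^+ 4) (q ^+ 8) * qpoch_inf (q ^+ 16) (q ^+ 16)); last by ring.
rewrite E1 E2 -mulrA -mulrA mulrCA.
by rewrite [X in _ * X]mulrA E3 -E4 expr2.
Qed.

Lemma has_sum3_second :
  has_sum3
    (fun i j k : nat => (-1) ^+ j
       * q ^+ ((i + j + 2 * k) * (i + j + 2 * k - 1)
               + 2 * i + 3 * j + 2 * k ^ 2 + 6 * k)%N
       / (qpoch q q i * qpoch (q ^+ 2) (q ^+ 2) j * qpoch (q ^+ 4) (q ^+ 4) k))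
    (qpoch_inf_seq [:: q ^+ 4; q ^+ 12; q ^+ 16] (q ^+ 16)
     / qpoch_inf (q ^+ 2) (q ^+ 2)).
Proof.
rewrite -qpoch_inf_quotient_second.
apply: (@sum_bound (fun i j k => (i + j + 2 * k) * (i + j + 2 * k - 1)
               + 2 * i + 3 * j + 2 * k ^ 2 + 6 * k)%N) => [i j k|].
  by have := bin2_sqr (i + j + 2 * k); rewrite mulnBr muln1 mulnn; lia.
have q41' : `|q ^+ 4| <= 1 by exact: ltW.
have := @double_sum_cvg _ q41'.
set u := (X in X @ _ --> _ -> _); set v := (X in _ -> X @ _ --> _).
suff -> : u = (fun n => v n.+1) by rewrite (cvg_shiftS v).
apply/funext => n; rewrite /u /v.
(* From 2i + 3j + 6k = 2N + j + 2k, the part 2N turns N(N - 1) into N(N + 1), while j + 2k shifts z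
   to q z in two factors. *)
rewrite (@eq_box_sum _ _ (fun i j k => q ^+ ((i + j + 2 * k) * (i + j + 2 * k).+1) *
  (invqf q i * ((-1) ^+ j * q ^+ j * invqf (q ^+ 2) j)
   * (q ^+ (2 * k ^ 2 + 2 * k) * invqf (q ^+ 4) k)))) => [|i j k]; last first.
  rewrite !invfM -!/(invqf _ _).
  set N := (i + j + 2 * k)%N.
  have NE : (N * N.+1 = N * (N - 1) + 2 * N)%N by case: N => // m; nia.
  have -> : (N * (N - 1) + 2 * i + 3 * j + 2 * k ^ 2 + 6 * k
    = N * N.+1 + j + (2 * k ^ 2 + 2 * k))%N.
    by rewrite NE; move: (N * (N - 1))%N => M; rewrite /N; lia.
  by rewrite !exprD; ring.
rewrite (box_sum_cprod (fun m => q ^+ (m * m.+1)) _ (fun m => cprod_invqf3_shift m q1)).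
apply: eq_bigr => r _; apply: eq_bigr => s _; case: ifP => // _.
have -> : ((s + 2 * r) * (s + 2 * r).+1 =
  4 * r ^ 2 + 2 * r + 2 * 'C(s, 2) + (4 * r + 2) * s)%N.
  by have := bin2_sqr s; nia.
rewrite -!exprM !exprD (_ : 4 * r = 2 * r + 2 * r)%N ?exprD; [ring|lia].
Qed.

Lemma has_sum3_third :
  has_sum3
    (fun i j k : nat => (-1) ^+ j
       * q ^+ ((i + j + 2 * k) ^ 2 + 2 * k ^ 2)%N
       / (qpoch q q i * qpoch (q ^+ 2) (q ^+ 2) j * qpoch (q ^+ 4) (q ^+ 4) k))
    (qpoch_inf (q ^+ 8) (q ^+ 8) ^+ 2
     / (qpoch_inf (q ^+ 2) (q ^+ 2) * qpoch_inf (q ^+ 16) (q ^+ 16))).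
Proof.
rewrite -qpoch_inf_quotient_third.
apply: (@sum_bound (fun i j k => (i + j + 2 * k) ^ 2 + 2 * k ^ 2)%N) => [i j k|].
  by have := bin2_sqr (i + j + 2 * k); lia.
have le11 : `|1 : K| <= 1 by rewrite normr1.
have := @double_sum_cvg _ le11.
set u := (X in X @ _ --> _ -> _); set v := (X in _ -> X @ _ --> _).
suff -> : u = (fun n => v n.+1) by rewrite (cvg_shiftS v).
apply/funext => n; rewrite /u /v.
rewrite (@eq_box_sum _ _ (fun i j k => q ^+ ((i + j + 2 * k) ^ 2) *
  (invqf q i * ((-1) ^+ j * invqf (q ^+ 2) j)
   * (q ^+ (2 * k ^ 2) * invqf (q ^+ 4) k)))) => [|i j k]; last first.
  by rewrite !invfM -!/(invqf _ _) exprD; ring.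
rewrite (box_sum_cprod (fun m => q ^+ (m ^ 2)) _ (fun m => cprod_invqf3 m q1)).
apply: eq_bigr => r _; apply: eq_bigr => s _; case: ifP => // _.
rewrite expr1n mulr1.
have -> : ((s + 2 * r) ^ 2 = 4 * r ^ 2 + 2 * 'C(s, 2) + (4 * r) * s + s)%N.
  by have := bin2_sqr s; nia.
by rewrite -!exprM mulnDl !exprD; ring.
Qed.

End TripleSeries.

End Convergence.

(** * The two convergence assumptions over the complex numbers *)

Section ComplexConvergence.
Local Open Scope classical_set_scope.
Context {R : realType}.
Local Notation C := (R[i] : numFieldType).

Lemma norm_real_complex (x : R) : `|x%:C| = `|x|%:C :> R[i].
Proof. by rewrite normc_def /= expr0n addr0 sqrtr_sqr. Qed.

Lemma cvg_real_complex (u : nat -> R) (l : R) : u n @[n --> \oo] --> l ->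
  (u n)%:C @[n --> \oo] --> (l%:C : C).
Proof.
(* A positive radius in [R[i]] has zero imaginary part, so it is a real radius. *)
move=> ul; apply: (iffRL (@cvgrPdist_lt C C nat \oo _ _ _)) => -[e e'] /=.
rewrite ltcE /= => /andP[/eqP -> e0].
have /cvgrPdist_lt/(_ e e0) := ul; apply: filterS => n.
by rewrite -rmorphB norm_real_complex ltcR.
Qed.

Lemma cvg_geometric_complex (x : C) : `|x| < 1 -> x ^+ n @[n --> \oo] --> (0 : C).
Proof.
move=> x1; apply: norm_cvg0.
have xE : `|x| = (complex.Re `|x|)%:C by rewrite normc_def.
move: x1; under eq_fun do rewrite normrX; rewrite xE; set r := complex.Re _.
rewrite ltcR => r1.
under eq_fun do rewrite -rmorphXn.
apply: cvg_real_complex; apply: cvg_expr.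
by rewrite ger0_norm // -ler0c -xE.
Qed.

Lemma cvg_geometric_dominated_real (a : nat -> R) (M : R) :
  (forall n, `|a n| <= M * 2^-1 ^+ n) ->
  exists l : R, \sum_(k < n) a k @[n --> \oo] --> l.
Proof.
move=> aM.
have : cvgn (series a).
  apply: normed_cvg; apply: (@series_le_cvg _ _ (geometric M 2^-1)) => [n|n|n|].
  - exact: normr_ge0.
  - exact: le_trans (aM n).
  - exact: aM.
  - by apply: is_cvg_geometric_series; rewrite ger0_norm // invf_lt1 // ltr1n.
rewrite /series /= => h; exists (lim (\sum_(0 <= k < n) a k @[n --> \oo])).
by under eq_fun do rewrite -(big_mkord xpredT).
Qed.

(** Real and imaginary parts are at most the norm in absolute value, so each series is dominated
    with the constant [complex.Re M]. *)
Lemma cvg_geometric_dominated_complex (a : nat -> C) (M : C) :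
  (forall n, `|a n| <= M * 2^-1 ^+ n) ->
  exists l : C, \sum_(k < n) a k @[n --> \oo] --> l.
Proof.
move=> aM.
have aM' n : complex.Re `|a n| <= complex.Re M * 2^-1 ^+ n.
  have := aM n; rewrite lecE => /andP[_].
  have -> : 2^-1 ^+ n = (2^-1 ^+ n)%:C :> C.
    by rewrite rmorphXn fmorphV rmorph_nat.
  by case: M {aM} => [x y] /=; rewrite mulr0 subr0.
have [|lr rl] := @cvg_geometric_dominated_real (fun n => complex.Re (a n)) (complex.Re M).
  move=> n; apply: le_trans (aM' n); have := normc_ge_Re (a n).
  by rewrite lecE => /andP[].
have [|li il] := @cvg_geometric_dominated_real (fun n => complex.Im (a n)) (complex.Re M).
  move=> n; apply: le_trans (aM' n); rewrite normc_def /=.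
  by rewrite -sqrtr_sqr ler_wsqrtr // lerDr sqr_ge0.
exists (lr%:C + 'i * li%:C).
have -> : (fun n => \sum_(k < n) a k) =
  (fun n => (\sum_(k < n) complex.Re (a k))%:C + 'i * (\sum_(k < n) complex.Im (a k))%:C).
  apply/funext => n; rewrite !rmorph_sum mulr_sumr -big_split.
  by apply: eq_bigr => k _ /=; rewrite -complexE.
apply: cvgD; first exact: cvg_real_complex.
by apply: cvgM; [exact: cvg_cst|exact: cvg_real_complex].
Qed.

End ComplexConvergence.

Theorem theorem4p9 (R : realType) (q u : R[i]) (hq : 0 < `|q| < 1) :
  [/\ has_sum3
        (fun i j k : nat =>
           (-1) ^+ k
           * q ^+ ((i + j + 2 * k) * (i + j + 2 * k - 1) + j + 2 * k ^ 2)%N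
           * u ^+ (i + 2 * j + 4 * k)%N
           / (qpoch q q i * qpoch (q ^+ 2) (q ^+ 2) j
              * qpoch (q ^+ 4) (q ^+ 4) k))
        (qpoch_inf (- u) q),
      has_sum3
        (fun i j k : nat =>
           (-1) ^+ j
           * q ^+ ((i + j + 2 * k) * (i + j + 2 * k - 1)
                   + 2 * i + 3 * j + 2 * k ^ 2 + 6 * k)%N
           / (qpoch q q i * qpoch (q ^+ 2) (q ^+ 2) j
              * qpoch (q ^+ 4) (q ^+ 4) k))
        (qpoch_inf_seq [:: q ^+ 4; q ^+ 12; q ^+ 16] (q ^+ 16)
         / qpoch_inf (q ^+ 2) (q ^+ 2)) &
      has_sum3
        (fun i j k : nat =>
           (-1) ^+ j
           * q ^+ ((i + j + 2 * k) ^ 2 + 2 * k ^ 2)%N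
           / (qpoch q q i * qpoch (q ^+ 2) (q ^+ 2) j
              * qpoch (q ^+ 4) (q ^+ 4) k))
        (qpoch_inf (q ^+ 8) (q ^+ 8) ^+ 2
         / (qpoch_inf (q ^+ 2) (q ^+ 2) * qpoch_inf (q ^+ 16) (q ^+ 16)))].
Proof.
have /andP[_ q1] := hq.
have geom := @cvg_geometric_complex R.
have compl := @cvg_geometric_dominated_complex R.
split.
- exact: (has_sum3_euler geom compl q1).
- exact: (has_sum3_second geom compl q1).
- exact: (has_sum3_third geom compl q1).
Qed.
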